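(* Let $\nu$ be a probability measure on $\mathcal{X}$, suppose that $\mathcal{V}$ is compactly embedded in $L^2(\nu)$ and that $\int k(x,x)\,\mathrm{d}\nu(x)<\infty$. Suppose that the eigenvalue sequence $\lambda=(\lambda_m)_{m\in\mathbb{N}}$ of the integral operator $\Sigma$ satisfies either - $\lambda_m\asymp m^{-2s}$ for some $s>1/2$, or - $\lambda_m\asymp\alpha^m$ for some $\alpha\in(0,1)$. Then there is a constant $B$, with $B=B^{\mathrm{alg}}(s)\asymp(1+\frac{1}{2s-1})^{2s}$ in the first case and $B=B^{\mathrm{exp}}(\alpha)\asymp\frac{\alpha}{1-\alpha}$ in the second case, such that the following holds. Let $\boldsymbol{x}\in\mathcal{X}^n$ be drawn from the (unnormalised) continuous volume sampling distribution $\det(K(\boldsymbol{x}))\,\mathrm{d}\nu^{\otimes n}(\boldsymbol{x})$, and let $\mathcal{V}_d\subseteq\Sigma^{1/2}\mathcal{V}$. Then for any $\varepsilon\in(0,1)$, $$\mathbb{P}\Bigl[\mu(\boldsymbol{x})\ge\tfrac{1}{\sqrt{1-\varepsilon^2}}\Bigr]\le\frac{(2+B)\,d\,C_d^2\,\lambda_n}{\varepsilon^2},\qquad C_d:=\max_{0\neq v\in\mathcal{V}_d}\frac{\|\Sigma^{-1/2}v\|_{\mathcal{V}}}{\|v\|_{\mathcal{V}}}.$$ Moreover, if $\mathcal{V}_d=\operatorname{span}\{\phi_1,\dots,\phi_d\}$, then $C_d^2=\lambda_d^{-1}$.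
   Context: $\mathcal{V}$ is a real reproducing kernel Hilbert space of functions on $\mathcal{X}$ with norm $\|\cdot\|_{\mathcal{V}}$ and reproducing kernel $k$; $\mathcal{V}_d\subseteq\mathcal{V}$ is a $d$-dimensional subspace. The integral operator $\Sigma: v\mapsto\int_{\mathcal{X}}k(\cdot,y)v(y)\,\mathrm{d}\nu(y)$ is compact on $L^2(\nu)$ and has the spectral decomposition $\Sigma=\sum_{m}\lambda_m\phi_m(\phi_m,\cdot)_{L^2(\nu)}$, where $\lambda_1\ge\lambda_2\ge\dots>0$ and $\{\phi_m\}$ is an $L^2(\nu)$-orthonormal and $\mathcal{V}$-orthogonal system; the kernel is $k(x,y)=\sum_m\lambda_m\phi_m(x)\phi_m(y)$ with pointwise convergence, and the condition $\int k(x,x)\,\mathrm{d}\nu(x)=\sum_m\lambda_m<\infty$ says that $\Sigma$ is trace class. Powers of $\Sigma$ are defined spectrally: $\Sigma^{-1/2}v=\sum_l\lambda_l^{-1/2}(v,\phi_l)_{L^2(\nu)}\phi_l$. For $\boldsymbol{x}=(x_1,\dots,x_n)\in\mathcal{X}^n$: $K(\boldsymbol{x}):=(k(x_i,x_j))_{i,j}\in\mathbb{R}^{n\times n}$, $\mathcal{V}_{\boldsymbol{x}}:=\operatorname{span}\{k(x_1,\cdot),\dots,k(x_n,\cdot)\}$, $P_{\mathcal{V}_{\boldsymbol{x}}}$ is the $\mathcal{V}$-orthogonal projection onto $\mathcal{V}_{\boldsymbol{x}}$, and $\mu(\boldsymbol{x}):=\max_{0\ne v\in\mathcal{V}_d}\|v\|_{\mathcal{V}}/\|P_{\mathcal{V}_{\boldsymbol{x}}}v\|_{\mathcal{V}}\in(0,\infty]$.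 Drawing $\boldsymbol{x}$ from an unnormalised finite measure means drawing it from the corresponding normalised probability measure. $a\asymp b$ means $c\,b\le a\le c'\,b$ for some constants $c,c'>0$. The constant $B$ depends neither on $n$, $d$, $\mathcal{V}_d$ nor on $\varepsilon$. *)

(* Defs.v *)
From HB Require Import structures.
From mathcomp Require Import all_boot all_order all_algebra sesquilinear.
From mathcomp Require Import all_classical all_reals all_analysis.

Set Implicit Arguments.
Unset Strict Implicit.
Unset Printing Implicit Defensive.
Import Order.TTheory GRing.Theory Num.Theory.
Import numFieldNormedType.Exports.

Local Open Scope classical_set_scope.
Local Open Scope ring_scope.

Section asymptotic_equivalence.
Context {R : realType} {T : Type}.
Implicit Types (D : set T) (a b : T -> R).

Definition asymp_with (c c' : R) D a b :=
  forall t, D t -> c * b t <= a t <= c' * b t.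

Definition asymp D a b :=
  exists c c' : R, [/\ 0 < c, 0 < c' & asymp_with c c' D a b].

End asymptotic_equivalence.

Section power_measure.
Context d (X : measurableType d) (R : realType).

Definition cons_pair n (p : X * n.-tuple X) : n.+1.-tuple X :=
  [tuple of p.1 :: p.2].

Lemma measurable_cons_pair n : measurable_fun [set: X * n.-tuple X] (@cons_pair n).
Proof. exact: measurable_cons. Qed.

HB.instance Definition _ n :=
  isMeasurableFun.Build _ _ _ _ (@cons_pair n) (@measurable_cons_pair n).

(* the n-fold product of nu with itself, on tuples *)
Fixpoint power_probability (nu : probability X R) n :
    probability (n.-tuple X) R :=
  match n with
  | 0%N => \d_([tuple] : 0.-tuple X)
  | m.+1 => distribution (nu \x power_probability nu m)%E (@cons_pair m)
  end.

End power_measure.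

Section linear_combinations.
Context {R : realType} {V : lmodType R}.

Definition linear_span n (b : 'I_n -> V) : set V :=
  [set \sum_(i < n) a i *: b i | a in [set: 'I_n -> R]].

Definition linear_independent n (b : 'I_n -> V) :=
  forall a : 'I_n -> R, \sum_(i < n) a i *: b i = 0 -> forall i, a i = 0.

Definition subspace_of_dim n (W : set V) :=
  exists2 b : 'I_n -> V, linear_independent b & W = linear_span b.

End linear_combinations.

(* A reproducing kernel Hilbert space of functions on X: a Hilbert space whose
   elements v are identified, through the injective linear map [ev], with
   functions [ev v] on X; [ksec x] is the function k(x, .). *)
Record rkhs (R : realType) (X : Type) := Rkhs {
  rkhs_space :> completeNormedModType R ;
  ip : {dot rkhs_space for idfun} ;
  ip_norm : forall v, `|v| ^+ 2 = ip v v ;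
  ev : {linear rkhs_space -> (X -> R)} ;
  ev_inj : injective ev ;
  ksec : X -> rkhs_space ;
  reproducing : forall v x, ev v x = ip v (ksec x)
}.
Arguments ip {R X} r.
Arguments ev {R X} r.
Arguments ksec {R X} r.

Definition rkernel (R : realType) (X : Type) (V : rkhs R X) (x y : X) : R :=
  ev V (ksec V x) y.

(* p is unique when it exists, and it exists when W is a closed subspace. *)
Definition orth_proj (R : realType) (X : Type) (V : rkhs R X)
    (W : set V) (v : V) : V :=
  xget 0 [set p | W p /\ forall w, W w -> ip V (v - p) w = 0].

Section L2.
Context d (X : measurableType d) (R : realType).
Variable nu : probability X R.

Definition l2_ip (f g : X -> R) : R := \int[nu]_x (f x * g x).

Definition cvg_l2 (u : (X -> R)^nat) (f : X -> R) :=
  'N[nu]_2%:E[EFin \o (u n \- f)%R]%E @[n --> \oo] --> 0%E.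

Variable V : rkhs R X.

Definition compactly_embedded :=
  [/\ forall v : V, ev V v \in Lfun nu 2%:E,
      forall v : V, {ae nu, forall x, ev V v x = 0} -> v = 0 &
      forall u : nat -> V, (exists M : R, forall n, `|u n| <= M) ->
        exists (s : nat -> nat) (g : X -> R),
          [/\ {homo s : m n / (m < n)%N}, g \in Lfun nu 2%:E &
              cvg_l2 (fun n => ev V (u (s n))) g]].

Definition integral_operator (v : X -> R) : X -> R :=
  fun x => \int[nu]_y (rkernel V x y * v y).

(* Indices start at 0: [lam m] and [phi m] stand for the eigenvalue and
   eigenfunction of rank m + 1. *)
Variables (lam : nat -> R) (phi : nat -> V).

Record spectral_decomposition : Prop := {
  spectral_pos : forall m, 0 < lam m ;
  spectral_nonincreasing : forall l m, (l <= m)%N -> lam m <= lam l ;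
  spectral_orthonormal : forall l m,
    l2_ip (ev V (phi l)) (ev V (phi m)) = (l == m)%:R ;
  spectral_orthogonal : forall l m, l != m -> ip V (phi l) (phi m) = 0 ;
  spectral_sum : forall v, v \in Lfun nu 2%:E ->
    cvg_l2 (fun M x => \sum_(m < M)
              lam m * l2_ip (ev V (phi m)) v * ev V (phi m) x)
           (integral_operator v) ;
  spectral_kernel : forall x y,
    \sum_(m < M) lam m * ev V (phi m) x * ev V (phi m) y @[M --> \oo]
      --> rkernel V x y
}.

(* The power p of the integral operator, applied to an element of V: the
   L2(nu)-sum of the spectral series, as an element of V (at most one when V
   embeds injectively in L2(nu); 0 by default if there is none). *)
Definition spectral_power (p : R) (v : V) : V :=
  xget 0 [set w | cvg_l2 (fun M x => \sum_(l < M)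
                    lam l `^ p * l2_ip (ev V v) (ev V (phi l)) * ev V (phi l) x)
                  (ev V w)].

(* The supremum is attained when W is finite-dimensional, nonzero and contained
   in the range of [spectral_power 2^-1]. *)
Definition smoothness_const (W : set V) : \bar R :=
  ereal_sup [set (`|spectral_power (- 2^-1) v| / `|v|)%:E | v in W `\ 0].

End L2.

Section volume_sampling.
Context d (X : measurableType d) (R : realType).
Variables (nu : probability X R) (V : rkhs R X) (n : nat).
Implicit Types (x : n.-tuple X) (W : set V).

Definition kernel_mx x : 'M[R]_n :=
  \matrix_(i, j) rkernel V (tnth x i) (tnth x j).

Definition sample_space x : set V := linear_span (fun i : 'I_n => ksec V (tnth x i)).

(* Division is that of the extended reals, with 0^-1 = +oo. The supremum is
   attained when W is finite-dimensional and nonzero. *)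
Definition stability_const W x : \bar R :=
  ereal_sup [set (`|v|%:E / `|orth_proj (sample_space x) v|%:E)%E
            | v in W `\ 0].

(* The density det (kernel_mx x) is nonnegative, kernel_mx x being a Gram
   matrix. *)
Definition volume_sampling (A : set (n.-tuple X)) : \bar R :=
  (\int[power_probability nu n]_(x in A) (\det (kernel_mx x))%:E /
   \int[power_probability nu n]_x (\det (kernel_mx x))%:E)%E.

End volume_sampling.

(* Main.v *)
From HB Require Import structures.
Require Import Defs.
From mathcomp Require Import all_boot all_order all_algebra sesquilinear.
From mathcomp Require Import all_classical all_reals all_analysis.
From mathcomp Require Import perm measurable_realfun ring lra.

Set Implicit Arguments.
Unset Strict Implicit.
Unset Printing Implicit Defensive.
Import Order.TTheory GRing.Theory Num.Theory.
Import numFieldNormedType.Exports.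
Local Open Scope classical_set_scope.
Local Open Scope ring_scope.

(** Write [e m] for [Num.sqrt (lam m) *: phi m] and D_n for the integral of
    det K(x) over the n-fold product of nu; eigenvalues are counted from 0.

    The [e m] form a complete orthonormal system of V, in which the L2(nu) inner
    product is diagonal with entries [lam m] ([l2_phi], [total_eigenbasis],
    [l2_eigenbasis]).  Let f_1, ..., f_d satisfy v = sum_i <v, f_i> f_i for all
    v in V_d.  If mu(x) is at least 1 / sqrt(1 - eps^2), then some v in V_d
    loses a fraction at least eps^2 of its squared norm when it is projected
    onto V_x, and Cauchy-Schwarz gives sum_i |f_i - P f_i|^2 >= eps^2
    ([stability_const_frame]).  By Markov's inequality the probability is at
    most eps^-2 times the sum of the mean squared residuals of the f_i, so it
    is enough to bound the mean squared residual of a single vector v.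

    The determinant of volume sampling makes this mean computable: det K(x)
    times |v - P v|^2 is the Gram determinant of v, k(x_1, .), ..., k(x_n, .)
    ([det_gram_cons]).  Expand a Gram determinant in the coordinates along the
    [e m] and integrate one variable after the other.  By orthogonality in
    L2(nu), only index tuples with distinct entries survive
    ([sum_sign_prod_trig]), so that D_n is the sum of
    lam_(u_1) ... lam_(u_n) over injective u, and the integral of
    det K(x) |v - P v|^2 is the sum of <v, e_(u_0)>^2 lam_(u_1) ... lam_(u_n)
    over injective (u_0, ..., u_n) ([integral_det_gram]).

    If w is Sigma^(-1/2) v, then <v, e_m>^2 = lam_m <w, e_m>^2, so the last sum
    carries the full weight lam_(u_0) ... lam_(u_n) with a factor
    <w, e_(u_0)>^2.  The weight is symmetric, so the factor may be averaged over
    the n + 1 positions, which bounds the sum by |w|^2 D_(n+1) / (n + 1).  An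
    injective tuple of length n + 1 has at least n + 1 - m entries that are at
    least m, whence, for every m <= n,
      D_(n+1) / (n + 1) <= D_n (sum_(j >= m) lam_j) / (n + 1 - m)
    ([inj_sum_ratio]).  For algebraic decay with exponent 2 s the choice of m
    close to n (1 - 1 / (2 s)), and for exponential decay m = n, bound the right
    side by B D_n times the n-th eigenvalue, B being c' / c times the function
    to which it has to be equivalent ([alg_decay_tail], [exp_decay_tail]).

    Index sums are first taken over a finite range of size M; dominated
    convergence then lets M tend to infinity. *)

(** * Finite sums and inner products *)
Section single_term_sum.

Lemma sum_ord_single (U : nmodType) n l (ln : (l < n)%N) (F : 'I_n -> U) :
  (forall k : 'I_n, k != l :> nat -> F k = 0) ->
  \sum_(k < n) F k = F (Ordinal ln).
Proof.
by move=> F0; rewrite (bigD1 (Ordinal ln))//= big1 ?addr0// => k kl; exact: F0.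
Qed.

End single_term_sum.

Section inner_product.
Context {R : realType} {X : Type} (V : rkhs R X).
Implicit Types (u v w f : V).

Lemma ipC u v : ip V u v = ip V v u.
Proof. by have := hermC (ip V) u v; rewrite /= expr0 mul1r. Qed.

Lemma ipDl u v w : ip V (u + v) w = ip V u w + ip V v w.
Proof. exact: linearDl. Qed.

Lemma ipZl (a : R) u v : ip V (a *: u) v = a * ip V u v.
Proof. exact: linearZl_LR. Qed.

Lemma ipBl u v w : ip V (u - v) w = ip V u w - ip V v w.
Proof. exact: linearBl. Qed.

Lemma ip0l v : ip V 0 v = 0.
Proof. exact: linear0l. Qed.

Lemma ip_suml I (s : seq I) (P : pred I) (F : I -> V) v :
  ip V (\sum_(i <- s | P i) F i) v = \sum_(i <- s | P i) ip V (F i) v.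
Proof. exact: linear_sumlz. Qed.

Lemma ipDr u v w : ip V w (u + v) = ip V w u + ip V w v.
Proof. by rewrite ipC ipDl ![ip V _ w]ipC. Qed.

Lemma ipZr (a : R) u v : ip V v (a *: u) = a * ip V v u.
Proof. by rewrite ipC ipZl ipC. Qed.

Lemma ipBr u v w : ip V w (u - v) = ip V w u - ip V w v.
Proof. by rewrite ipC ipBl ![ip V _ w]ipC. Qed.

Lemma ip0r v : ip V v 0 = 0.
Proof. by rewrite ipC ip0l. Qed.

Lemma ip_sumr I (s : seq I) (P : pred I) (F : I -> V) v :
  ip V v (\sum_(i <- s | P i) F i) = \sum_(i <- s | P i) ip V v (F i).
Proof. by rewrite ipC ip_suml; apply: eq_bigr => i _; rewrite ipC. Qed.

Lemma ip_ge0 v : 0 <= ip V v v.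
Proof. by rewrite -ip_norm sqr_ge0. Qed.

Lemma ip_eq0 v : ip V v v = 0 -> v = 0.
Proof. by move=> /eqP; rewrite -ip_norm sqrf_eq0 normr_eq0 => /eqP. Qed.

(** Expand the squared norm of |v|^2 u - <u, v> v. *)
Lemma ip_le_norm u v : `|ip V u v| <= `|u| * `|v|.
Proof.
have [->|v0] := eqVneq v 0; first by rewrite ip0r normr0 mulr_ge0.
have vv : 0 < `|v| ^+ 2 by rewrite exprn_gt0// normr_gt0.
have : 0 <= ip V (`|v| ^+ 2 *: u - ip V u v *: v) (`|v| ^+ 2 *: u - ip V u v *: v).
  exact: ip_ge0.
rewrite !(ipBl, ipBr, ipZl, ipZr) -!ip_norm (ipC v u).
set a := ip V u v; set b := `|v|; set c := `|u| => H.
have H2 : 0 <= b ^+ 2 * ((c * b) ^+ 2 - a ^+ 2).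
  rewrite (le_trans H)// le_eqVlt; apply/orP; left; apply/eqP; ring.
rewrite pmulr_rge0// subr_ge0 in H2.
rewrite -(@ler_pXn2r _ 2)// ?nnegrE ?mulr_ge0 /b /c//.
by rewrite real_normK// num_real.
Qed.

End inner_product.

(** * Gram determinants and orthogonal projections *)
Section gram.
Context {R : realType} {X : Type} (V : rkhs R X).

Definition gram n (a : 'I_n -> V) : 'M[R]_n := \matrix_(i, j) ip V (a i) (a j).

Lemma linear_span_mem n (a : 'I_n -> V) i : linear_span a (a i).
Proof.
exists (fun j => (j == i)%:R) => //.
by rewrite (sum_ord_single (ltn_ord i)) /= => [|k /negPf ki];
  rewrite -val_eqE/= ?eqxx ?scale1r ?ki ?scale0r//; congr a; exact: val_inj.
Qed.

(** The property by which [orth_proj] picks its value. *)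
Definition span_orth n (a : 'I_n -> V) (v p : V) :=
  linear_span a p /\ forall w, linear_span a w -> ip V (v - p) w = 0.

(** One Gram-Schmidt step: project the first vector onto the span of the
    others, and add to the projection of [v] onto that span its component along
    the remainder [r]. *)
Lemma span_orth_exists n (a : 'I_n -> V) v : exists p, span_orth a v p.
Proof.
elim: n a v => [|n IH] a v.
  exists 0; split; first by exists (fun=> 0) => //; rewrite big_ord0.
  by move=> _ [c _ <-]; rewrite big_ord0 ip0r.
have mem i : linear_span (fun j => a (lift ord0 j)) (a (lift ord0 i)).
  exact: (linear_span_mem (fun j => a (lift ord0 j)) i).
have [p0 [[c0 _ c0E] o0]] := IH (fun j => a (lift ord0 j)) (a ord0).
have [p1 [[c1 _ c1E] o1]] := IH (fun j => a (lift ord0 j)) v.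
pose r := a ord0 - p0.
(* When [r = 0], division by zero gives [t = 0], which is the right value. *)
pose t := ip V (v - p1) r / ip V r r.
exists (p1 + t *: r); split.
  exists (fun i => if unlift ord0 i is Some j then c1 j - t * c0 j else t) => //.
  rewrite big_ord_recl unlift_none.
  under eq_bigr do rewrite liftK scalerBl -scalerA.
  by rewrite sumrB -scaler_sumr c1E c0E /r scalerBr addrCA.
have orth j : ip V (v - (p1 + t *: r)) (a (lift ord0 j)) = 0.
  by rewrite opprD addrA ipBl ipZl o1// o0// mulr0 subr0.
have rE : a ord0 = r + p0 by rewrite /r subrK.
have orthr : ip V (v - (p1 + t *: r)) r = 0.
  rewrite opprD addrA ipBl ipZl /t.
  have [r0|r0] := eqVneq (ip V r r) 0; last by rewrite divfK// subrr.
  by rewrite (ip_eq0 r0) !ip0r mulr0 subrr.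
move=> _ [c _ <-].
rewrite ip_sumr big_ord_recl ipZr rE ipDr orthr add0r -c0E ip_sumr.
rewrite big1 ?mulr0 ?add0r => [|j _]; last by rewrite ipZr orth mulr0.
by rewrite big1// => j _; rewrite ipZr orth mulr0.
Qed.

Lemma orth_projP n (a : 'I_n -> V) v :
  span_orth a v (orth_proj (linear_span a) v).
Proof.
by rewrite /orth_proj; case: xgetP => [p //|no]; have [p /no] := span_orth_exists a v.
Qed.

Definition vcons n (v : V) (a : 'I_n -> V) (i : 'I_n.+1) : V :=
  if unlift ord0 i is Some j then a j else v.

Lemma vcons0 n v (a : 'I_n -> V) : vcons v a ord0 = v.
Proof. by rewrite /vcons unlift_none. Qed.

Lemma vconsS n v (a : 'I_n -> V) j : vcons v a (lift ord0 j) = a j.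
Proof. by rewrite /vcons liftK. Qed.

(** Replacing [v] by its residual is a unitriangular change of vectors, which
    leaves the determinant unchanged, and the residual is orthogonal to the
    other vectors.  This turns the volume sampling density times a squared
    residual into a single determinant. *)
Lemma det_gram_cons n (v : V) (a : 'I_n -> V) :
  \det (gram (vcons v a)) =
  `|v - orth_proj (linear_span a) v| ^+ 2 * \det (gram a).
Proof.
have [[c _ cE] orth] := orth_projP a v.
set p := orth_proj _ v in cE orth *.
pose U : 'M[R]_(1 + n) := block_mx 1%:M (\row_j c j) 0 1%:M.
pose D : 'M[R]_(1 + n) := block_mx (`|v - p| ^+ 2)%:M 0 0 (gram a).
have mem i : linear_span a (a i) by exact: linear_span_mem.
have -> : gram (vcons v a) = U *m D *m U^T.
  rewrite /U /D tr_block_mx !mulmx_block !trmx1 !trmx0 !mul0mx !mulmx0.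
  rewrite !mul1mx !mulmx1 !addr0 !add0r.
  have e0 : lshift n (ord0 : 'I_1) = ord0 :> 'I_(1 + n) by exact: val_inj.
  have eS j : rshift 1 j = lift ord0 j :> 'I_(1 + n) by exact: val_inj.
  have ipa j : ip V v (a j) = \sum_i c i * ip V (a i) (a j).
    rewrite -[v](subrK p) ipDl orth// add0r -cE ip_suml.
    by apply: eq_bigr => i _; rewrite ipZl.
  apply/(@matrixP _ (1 + n) (1 + n)) => i j; rewrite mxE.
  case: (@split_ordP 1 n i) => i' ->; case: (@split_ordP 1 n j) => j' ->;
    rewrite ?(block_mxEul, block_mxEur, block_mxEdl, block_mxEdr) ?ord1 ?e0 ?eS
      ?vcons0 ?vconsS.
  - have vp : ip V v p = ip V p p.
      by apply/eqP; rewrite -subr_eq0 -ipBl orth//; exists c.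
    have -> : ip V v v = ip V (v - p) (v - p) + ip V p p.
      by rewrite ipBl !ipBr (ipC p v) vp subrr subr0 subrK.
    rewrite !mxE eqxx mulr1n ip_norm; congr (_ + _).
    rewrite -{2}cE ip_sumr; apply: eq_bigr => k _; rewrite !mxE ipZr mulrC.
    by congr (_ * _); rewrite -cE ip_suml; apply: eq_bigr => l _; rewrite !mxE ipZl.
  - by rewrite !mxE ipa; apply: eq_bigr => k _; rewrite !mxE.
  - by rewrite !mxE ipC ipa; apply: eq_bigr => k _; rewrite !mxE mulrC ipC.
  - by rewrite !mxE.
have dU : \det U = 1 by rewrite det_ublock !det1 mulr1.
have dD : \det D = `|v - p| ^+ 2 * \det (gram a) by rewrite det_ublock det_scalar1.
by rewrite !det_mulmx det_tr dU dD mul1r mulr1.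
Qed.

Lemma det_gram_ge0 n (a : 'I_n -> V) : 0 <= \det (gram a).
Proof.
elim: n a => [a|n IH a]; first by rewrite det_mx00.
have -> : a = vcons (a ord0) (fun j => a (lift ord0 j)).
  apply/funext => i; case: (unliftP ord0 i) => [j|] ->; first by rewrite vconsS.
  by rewrite vcons0.
by rewrite det_gram_cons mulr_ge0// sqr_ge0.
Qed.

End gram.

(** * Sums of products over injective index tuples *)
Section injective_sums.
Context {R : realType} (lam : nat -> R).
Hypothesis lam_gt0 : forall m, 0 < lam m.

(** [N`!] times the elementary symmetric polynomial of degree [N] in
    [lam 0, ..., lam M.-1]; ordered tuples are what the integrals below
    produce, and they make the symmetrisation arguments plain reindexings. *)
Definition inj_sum (N M : nat) : R :=
  \sum_(u : {ffun 'I_N -> 'I_M} | injectiveb u) \prod_(i < N) lam (u i).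

Let weight_ge0 N M (u : {ffun 'I_N -> 'I_M}) : 0 <= \prod_(i < N) lam (u i).
Proof. by apply: prodr_ge0 => i _; exact: ltW. Qed.

Lemma inj_sum_ge0 N M : 0 <= inj_sum N M.
Proof. by apply: sumr_ge0 => u _; exact: weight_ge0. Qed.

Lemma inj_sum_ge N M : (N <= M)%N -> \prod_(i < N) lam i <= inj_sum N M.
Proof.
move=> NM; rewrite /inj_sum (bigD1 [ffun i => widen_ord NM i])/=.
  rewrite -[leLHS]addr0 lerD//; last by apply: sumr_ge0 => u _; exact: weight_ge0.
  by under [leRHS]eq_bigr do rewrite ffunE.
by apply/injectiveP => i j; rewrite !ffunE => /(congr1 val) /= /val_inj.
Qed.

(** The weight is invariant under permutations of the positions. *)
Lemma inj_sum_perm N M (g : nat -> R) (i0 : 'I_N.+1) :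
  \sum_(u : {ffun 'I_N.+1 -> 'I_M} | injectiveb u)
    g (u i0) * \prod_(i < N.+1) lam (u i) =
  \sum_(u : {ffun 'I_N.+1 -> 'I_M} | injectiveb u)
    g (u ord0) * \prod_(i < N.+1) lam (u i).
Proof.
pose h (u : {ffun 'I_N.+1 -> 'I_M}) : {ffun 'I_N.+1 -> 'I_M} :=
  [ffun i => u (tperm ord0 i0 i)].
have hK : involutive h by move=> u; apply/ffunP => i; rewrite !ffunE tpermK.
rewrite (reindex_inj (inv_inj hK)); apply: eq_big => [u|u _].
  apply/injectiveP/injectiveP => uinj i j.
    by move=> uij; apply: (@perm_inj _ (tperm ord0 i0)); apply: uinj;
      rewrite !ffunE !tpermK.
  by rewrite !ffunE => /uinj /perm_inj.
rewrite ffunE tpermR; congr (_ * _).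
rewrite (reindex_inj (@perm_inj _ (tperm ord0 i0)))/=.
by apply: eq_bigr => i _; rewrite ffunE tpermK.
Qed.

Lemma inj_sum_avg N M (g : nat -> R) :
  N.+1%:R * \sum_(u : {ffun 'I_N.+1 -> 'I_M} | injectiveb u)
    g (u ord0) * \prod_(i < N.+1) lam (u i) =
  \sum_(u : {ffun 'I_N.+1 -> 'I_M} | injectiveb u)
    (\sum_(i < N.+1) g (u i)) * \prod_(i < N.+1) lam (u i).
Proof.
under [RHS]eq_bigr do rewrite mulr_suml.
rewrite exchange_big/=.
rewrite mulr_natl -[X in _ *+ X](card_ord N.+1) -sumr_const.
by apply: eq_bigr => i _; rewrite (inj_sum_perm M g i).
Qed.

(** After averaging over positions, each index counts at most once in
    [\sum_i g (u i)] because [u] is injective. *)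
Lemma inj_sum_marked N M (g : nat -> R) : (forall m, 0 <= g m) ->
  N.+1%:R * \sum_(u : {ffun 'I_N.+1 -> 'I_M} | injectiveb u)
    g (u ord0) * \prod_(i < N.+1) lam (u i) <=
  (\sum_(m < M) g m) * inj_sum N.+1 M.
Proof.
move=> g0; rewrite inj_sum_avg /inj_sum mulr_sumr; apply: ler_sum => u /injectiveP uinj.
rewrite ler_wpM2r ?weight_ge0//.
have -> : \sum_(i < N.+1) g (u i) = \sum_(j in u @: [set: 'I_N.+1]%SET) g j.
  by rewrite big_imset/=; [apply: eq_bigl => i; rewrite inE|exact: in2W].
rewrite [leRHS](bigID (fun j => j \in u @: [set: 'I_N.+1]%SET))/=.
by rewrite lerDl sumr_ge0.
Qed.

(** Forget that the first index differs from the others. *)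
Lemma inj_sum_split N M (g : nat -> R) : (forall m, 0 <= g m) ->
  \sum_(u : {ffun 'I_N.+1 -> 'I_M} | injectiveb u)
    g (u ord0) * \prod_(i < N.+1) lam (u i) <=
  (\sum_(m < M) g m * lam m) * inj_sum N M.
Proof.
move=> g0.
pose h (p : 'I_M * {ffun 'I_N -> 'I_M}) : {ffun 'I_N.+1 -> 'I_M} :=
  [ffun i => if unlift ord0 i is Some j then p.2 j else p.1].
pose k (u : {ffun 'I_N.+1 -> 'I_M}) := (u ord0, [ffun j => u (lift ord0 j)]).
have hk : cancel h k.
  move=> [m u]; rewrite /k /h ffunE unlift_none/=; congr pair.
  by apply/ffunP => j; rewrite !ffunE liftK.
have kh : cancel k h.
  move=> u; apply/ffunP => i; rewrite ffunE.
  by case: (unliftP ord0 i) => [j|] ->; rewrite ?ffunE.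
rewrite (reindex h)/=; last by exists k => x _.
have pinj p : injectiveb (h p) -> injectiveb p.2.
  move/injectiveP => inj; apply/injectiveP => i j pij.
  apply: (@lift_inj _ ord0); apply: inj.
  by rewrite !ffunE !liftK.
have pE p : g (h p ord0) * \prod_(i < N.+1) lam (h p i) =
    (g p.1 * lam p.1) * \prod_(i < N) lam (p.2 i).
  rewrite big_ord_recl !ffunE unlift_none mulrA; congr (_ * _).
  by apply: eq_bigr => i _; rewrite ffunE liftK.
rewrite /inj_sum mulr_suml.
under [leRHS]eq_bigr do rewrite mulr_sumr.
rewrite pair_big_dep/= big_mkcond [leRHS]big_mkcond/=.
apply: ler_sum => p _; rewrite pE.
case: ifPn => [/pinj -> //|_]; case: ifPn => // _.
by rewrite !mulr_ge0 ?weight_ge0 ?(ltW (lam_gt0 _)).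
Qed.

(** An injective tuple of length [N.+1] uses each of the [m] smallest indices at
    most once, so at least [N.+1 - m] of its entries lie in the tail. *)
Lemma inj_sum_tail N M m : (m <= N)%N ->
  (N.+1 - m)%:R * inj_sum N.+1 M <=
  N.+1%:R * ((\sum_(m <= j < M) lam j) * inj_sum N M).
Proof.
move=> mN; pose g (j : nat) : R := (m <= j)%:R.
have g0 j : 0 <= g j by exact: ler0n.
have -> : \sum_(m <= j < M) lam j = \sum_(j < M) g j * lam j.
  rewrite big_geq_mkord big_mkcond/=; apply: eq_bigr => j _.
  by rewrite /g; case: ifP; rewrite ?mul1r ?mul0r.
apply: (@le_trans _ _ (N.+1%:R * \sum_(u : {ffun 'I_N.+1 -> 'I_M} | injectiveb u)
    g (u ord0) * \prod_(i < N.+1) lam (u i))); last first.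
  by rewrite ler_wpM2l ?inj_sum_split.
rewrite inj_sum_avg /inj_sum mulr_sumr; apply: ler_sum => u /injectiveP uinj.
rewrite ler_wpM2r ?weight_ge0// -natr_sum ler_nat.
pose low := [set i : 'I_N.+1 | (u i < m)%N]%SET.
have -> : (\sum_(i < N.+1) (m <= u i) = #|~: low|)%N.
  rewrite -sum1_card [RHS]big_mkcond/=; apply: eq_bigr => i _.
  by rewrite !inE -leqNgt; case: (m <= u i)%N.
have lowm : (#|low| <= m)%N.
  case: m @low {mN g g0} => [|m] low.
    by rewrite leqn0 cards_eq0; apply/eqP/setP => i; rewrite !inE.
  rewrite -[X in (_ <= X)%N]card_ord -(@card_in_imset _ _ (fun i => inord (u i) : 'I_m.+1)).
    exact: max_card.
  move=> i j; rewrite !inE => im jm /(congr1 val)/=; rewrite !inordK//.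
  by move=> /val_inj /uinj.
by rewrite leq_subLR (leq_trans _ (leq_add lowm (leqnn _)))// cardsC card_ord.
Qed.

(** The left side is the truncated integral of the volume sampling density times
    the squared residual of Sigma^(1/2) w, [w j] being the coordinates of w:
    averaging over the positions gains a factor [N.+1], which makes up for the
    one lost in [inj_sum_tail]. *)
Lemma inj_sum_ratio N M m (b : R) (w : nat -> R) : (m <= N)%N -> 0 <= b ->
  \sum_(m <= j < M) lam j <= b * (N.+1 - m)%:R ->
  \sum_(u : {ffun 'I_N.+1 -> 'I_M} | injectiveb u)
    w (u ord0) ^+ 2 * \prod_(i < N.+1) lam (u i) <=
  b * (\sum_(j < M) w j ^+ 2) * inj_sum N M.
Proof.
move=> mN b0 tail.
have N0 : 0 < N.+1%:R :> R by rewrite ltr0n.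
have Nm0 : 0 < (N.+1 - m)%:R :> R by rewrite ltr0n subn_gt0 ltnS.
have w0 : 0 <= \sum_(j < M) w j ^+ 2 by apply: sumr_ge0 => j _; exact: sqr_ge0.
rewrite -(ler_pM2l N0).
apply: (le_trans (@inj_sum_marked N M (fun j => w j ^+ 2) (fun j => sqr_ge0 (w j)))).
rewrite -(ler_pM2l Nm0) mulrCA.
apply: (@le_trans _ _ ((\sum_(j < M) w j ^+ 2) *
    (N.+1%:R * ((b * (N.+1 - m)%:R) * inj_sum N M)))).
  apply: ler_wpM2l => //; apply: (le_trans (inj_sum_tail M mN)).
  by rewrite ler_pM2l// ler_wpM2r ?inj_sum_ge0.
rewrite le_eqVlt; apply/orP; left; apply/eqP; ring.
Qed.

End injective_sums.

(** * Expansion of Gram determinants in coordinates *)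
Section gram_expansion.
Context {R : realType}.

(** In this form, the factor with index [i] only involves the [i]-th vector, so
    that the integral over independent points factorises. *)
Lemma det_sum_prod N M (c : 'I_N -> 'I_M -> R) :
  \det (\matrix_(i, j) \sum_(m < M) c i m * c j m) =
  \sum_(u : {ffun 'I_N -> 'I_M}) \sum_(s : 'S_N)
    (-1) ^+ s * \prod_i (c i (u i) * c i (u (s i))).
Proof.
rewrite exchange_big/= /determinant (reindex_inj (@invg_inj 'S_N))/=.
apply: eq_bigr => s _; rewrite odd_permV -mulr_sumr; congr (_ * _).
under eq_bigr do rewrite mxE.
rewrite bigA_distr_bigA/=; apply: eq_bigr => u _.
rewrite !big_split/=; congr (_ * _).
rewrite [RHS](reindex_inj (@perm_inj _ s^-1))/=.
by apply: eq_bigr => i _; rewrite permKV.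
Qed.

(** For fixed [u] the sum over permutations is the determinant with entries
    [G i (u i) (u j)]: it has two equal columns unless [u] is injective, and then
    it is triangular.  Row 0 is left arbitrary so that a fixed vector may
    precede the sampled ones. *)
Lemma sum_sign_prod_trig N M (G : 'I_N -> 'I_M -> 'I_M -> R) :
  (forall (i j : 'I_N) p q, (j < i)%N -> p != q -> G i p q = 0) ->
  \sum_(u : {ffun 'I_N -> 'I_M}) \sum_(s : 'S_N)
    (-1) ^+ s * \prod_i G i (u i) (u (s i)) =
  \sum_(u : {ffun 'I_N -> 'I_M} | injectiveb u) \prod_i G i (u i) (u i).
Proof.
move=> G0; rewrite [RHS]big_mkcond/=; apply: eq_bigr => u _.
pose A : 'M[R]_N := \matrix_(i, j) G i (u i) (u j).
transitivity (\det A).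
  by apply: eq_bigr => s _; congr (_ * _); apply: eq_bigr => i _; rewrite mxE.
case: ifPn => [/injectiveP uinj|/injectivePn[i [j ij uij]]].
  rewrite -det_tr det_trig.
    by apply: eq_bigr => i _; rewrite !mxE.
  apply/is_trig_mxP => i j ij; rewrite !mxE (G0 _ i)//.
  by apply/eqP => /uinj ji; rewrite ji ltnn in ij.
by rewrite -det_tr (determinant_alternate ij)// => k; rewrite !mxE uij.
Qed.

End gram_expansion.

(** * Tails of the eigenvalue sequence *)
Section eigenvalue_decay.
Context {R : realType}.

(** Convexity of t^(-p) between [j] and [j.+1], obtained from
    exp a >= 1 + a and ln (1 + a) <= a. *)
Lemma powR_telescope (p : R) (j : nat) : 0 < p -> (0 < j)%N ->
  p * j.+1%:R `^ (- (p + 1)) <= j%:R `^ (- p) - j.+1%:R `^ (- p).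
Proof.
move=> p0 j0.
have x0 : 0 < j%:R :> R by rewrite ltr0n.
have y0 : 0 < j.+1%:R :> R by rewrite ltr0n.
set x : R := j%:R in x0 *; set y : R := j.+1%:R in y0 *.
have yx : x = y - 1 by rewrite /x /y -natr1 addrK.
have xy0 : 0 < x / y by rewrite divr_gt0.
have xE : x `^ (- p) = y `^ (- p) * (x / y) `^ (- p).
  by rewrite -powRM ?ltW// mulrC divfK ?gt_eqF.
have yE : y `^ (- (p + 1)) = y `^ (- p) * y^-1.
  rewrite opprD powRD; last by rewrite (gt_eqF y0) implybT.
  by rewrite powR_inv1 ?ltW.
rewrite yE xE mulrCA -{3}[y `^ (- p)]mulr1 -mulrBr ler_wpM2l ?powR_ge0//.
rewrite lerBrDl /powR gt_eqF// (le_trans _ (expR_ge1Dx _))// lerD2l.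
rewrite mulNr -mulrN ler_wpM2l ?(ltW p0)// lerNr.
have := le_ln1Dx (x := x / y - 1); rewrite (addrC 1) subrK => H.
rewrite (le_trans (H _))//; first by rewrite ltrBrDl subrr.
by rewrite yx mulrBl divff ?gt_eqF// mul1r addrAC subrr add0r.
Qed.

Lemma powR_tail (p : R) (m M : nat) : 0 < p -> (0 < m)%N ->
  \sum_(m <= j < M) j.+1%:R `^ (- (p + 1)) <= m%:R `^ (- p) / p.
Proof.
move=> p0 m0.
have [Mm|mM] := leqP M m; first by rewrite big_geq// divr_ge0 ?powR_ge0 ?ltW.
rewrite ler_pdivlMr// mulrC mulr_sumr.
apply: (@le_trans _ _ (\sum_(m <= j < M) (j%:R `^ (- p) - j.+1%:R `^ (- p)))).
  apply: ler_sum_nat => j /andP[mj _]; apply: powR_telescope => //.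
  exact: leq_trans mj.
have -> : \sum_(m <= j < M) (j%:R `^ (- p) - j.+1%:R `^ (- p)) =
    - \sum_(m <= j < M) (j.+1%:R `^ (- p) - j%:R `^ (- p)) :> R.
  by rewrite -sumrN; apply: eq_bigr => j _; rewrite opprB.
rewrite (telescope_sumr (fun j => j%:R `^ (- p))); last exact: ltnW.
by rewrite opprB lerBlDr lerDl powR_ge0.
Qed.

(** With p = 2 s - 1 the tail from m is at most c' m^(-p) / p.  Dividing by
    n + 1 - m and minimising over real m gives m = x = n p / (p + 1), for which
    n - x = n / (p + 1) and the bound becomes c' (1 + 1 / p)^(p + 1) n^(-(p + 1)).
    Rounding x up decreases the tail, and n + 1 - m still is at least n - x. *)
Lemma alg_decay_tail (s c c' : R) (lam : nat -> R) n :
  2^-1 < s -> 0 < c -> 0 < c' -> (0 < n)%N ->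
  asymp_with c c' [set: nat] lam (fun m => m.+1%:R `^ (- (2 * s))) ->
  exists2 m, (m <= n)%N & forall M, \sum_(m <= j < M) lam j <=
    (c' / c * (1 + (2 * s - 1)^-1) `^ (2 * s)) * lam n.-1 * (n.+1 - m)%:R.
Proof.
move=> s2 c0 c'0 n0 lamE.
have [p [p0 pE]] : exists p, 0 < p /\ p = 2 * s - 1.
  by exists (2 * s - 1); split => //; lra.
have sE : 2 * s = p + 1 by rewrite pE subrK.
have nR0 : 0 < n%:R :> R by rewrite ltr0n.
pose r := p / (p + 1); pose x := n%:R * r.
have r0 : 0 < r by rewrite divr_gt0// addr_gt0.
have x0 : 0 < x by rewrite mulr_gt0.
have p1 : 0 < p + 1 by rewrite addr_gt0.
have r1 : r < 1.
  by rewrite /r ltr_pdivrMr // mul1r ltrDl.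
have xn : x < n%:R by rewrite gtr_pMr.
pose t := Num.truncn x.
have tx : t%:R <= x by rewrite truncn_le ltW.
have xt : x < t.+1%:R by exact: truncnS_gt.
have tn : (t < n)%N by rewrite -(ltr_nat R) (le_lt_trans tx).
exists t.+1 => // M; rewrite subSS -pE sE.
have lamn : c * n%:R `^ (- (p + 1)) <= lam n.-1.
  by have /andP[] := lamE n.-1 I; rewrite prednK// sE.
have -> : 1 + p^-1 = r^-1 by rewrite /r invf_div; field; exact: lt0r_neq0.
apply: (@le_trans _ _ (c' * (t.+1%:R `^ (- p) / p))).
  apply: (@le_trans _ _ (c' * \sum_(t.+1 <= j < M) j.+1%:R `^ (- (p + 1)))).
    rewrite mulr_sumr; apply: ler_sum => j _.
    by have /andP[] := lamE j I; rewrite sE.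
  by rewrite ler_pM2l// powR_tail.
apply: (@le_trans _ _ (c' * (x `^ (- p) / p))).
  rewrite ler_pM2l// ler_pM2r ?invr_gt0// !powRN lef_pV2 ?posrE ?powR_gt0//.
    by apply: ge0_ler_powR; rewrite ?nnegrE ?ltW.
apply: (@le_trans _ _
  (c' / c * r^-1 `^ (p + 1) * (c * n%:R `^ (- (p + 1))) * (n%:R - x))); last first.
  rewrite natrB ?(ltnW tn)//; apply: ler_pM; rewrite ?subr_ge0 ?(ltW xn)//.
  - by rewrite !mulr_ge0 ?invr_ge0 ?powR_ge0 ?ltW.
  - by rewrite ler_wpM2l// !mulr_ge0 ?invr_ge0 ?powR_ge0 ?ltW.
  - by rewrite lerD2l lerN2.
have nx : n%:R - x = n%:R / (p + 1).
  by rewrite /x /r; field; exact: lt0r_neq0.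
have xE : x `^ (- p) = n%:R `^ (- p) * r^-1 `^ p.
  rewrite /x powRM ?ltW//; congr (_ * _).
  by rewrite -(powR_inv1 (ltW r0)) -powRrM mulN1r.
have nE : n%:R `^ (- p) = n%:R `^ (- (p + 1)) * n%:R.
  by rewrite opprD powRD ?(gt_eqF nR0) ?implybT// powR_inv1 ?ltW// divfK ?gt_eqF.
have ri0 : 0 < r^-1 by rewrite invr_gt0.
have rE : r^-1 `^ (p + 1) = r^-1 `^ p * r^-1.
  by rewrite powRD ?(gt_eqF ri0) ?implybT// powRr1 ?invr_ge0 ?ltW.
rewrite nx xE nE rE invf_div; set a := _ `^ p; set b := _ `^ _.
rewrite le_eqVlt; apply/orP; left; apply/eqP; field.
by rewrite !gt_eqF ?addr_gt0.
Qed.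

(** The tail is dominated by its first term, so no averaging is needed: m = n
    and a geometric series. *)
Lemma exp_decay_tail (alpha c c' : R) (lam : nat -> R) n :
  0 < alpha < 1 -> 0 < c -> 0 < c' -> (0 < n)%N ->
  asymp_with c c' [set: nat] lam (fun m => alpha ^+ m.+1) ->
  exists2 m, (m <= n)%N & forall M, \sum_(m <= j < M) lam j <=
    (c' / c * (alpha / (1 - alpha))) * lam n.-1 * (n.+1 - m)%:R.
Proof.
move=> /andP[a0 a1] c0 c'0 n0 lamE; exists n => // M; rewrite subSnn mulr1.
have a10 : 0 < 1 - alpha by rewrite subr_gt0.
apply: (@le_trans _ _ (c' * \sum_(n <= j < M) alpha ^+ j.+1)).
  by rewrite mulr_sumr; apply: ler_sum => j _; have /andP[] := lamE j I.
apply: (@le_trans _ _ (c' * (alpha ^+ n.+1 / (1 - alpha)))).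
  rewrite ler_pM2l// ler_pdivlMr// mulr_suml.
  have [Mn|nM] := leqP M n; first by rewrite big_geq// exprn_ge0 ?ltW.
  under eq_bigr do rewrite mulrBr mulr1 -exprSr.
  rewrite -[leLHS]opprK -sumrN.
  under eq_bigr do rewrite opprB.
  rewrite (telescope_sumr (fun j => alpha ^+ j.+1)); last exact: ltnW.
  by rewrite opprB lerBlDr lerDl exprn_ge0 ?ltW.
have /andP[H _] := lamE n.-1 I; rewrite prednK// in H.
apply: (@le_trans _ _ (c' / c * (alpha / (1 - alpha)) * (c * alpha ^+ n))).
  rewrite exprS le_eqVlt; apply/orP; left; apply/eqP; field.
  by rewrite !gt_eqF.
by rewrite ler_wpM2l// !mulr_ge0 ?invr_ge0 ?ltW.
Qed.

End eigenvalue_decay.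

(** * Convergence and Riesz representation in the Hilbert space *)
Section hilbert.
Context {R : realType} {X : Type} (V : rkhs R X).

Lemma cvg_of_dist2 (u : nat -> V) (b : nat -> R) :
  (forall m n, (m <= n)%N -> `|u m - u n| ^+ 2 <= b m) ->
  b n @[n --> \oo] --> 0 -> exists v : V, u n @[n --> \oo] --> v.
Proof.
move=> ub b0; suff /cvg_ex[v uv] : cvg (u n @[n --> \oo]) by exists v.
apply: cauchy_cvg; apply: cauchy_exP => eps eps0.
have e2 : 0 < eps ^+ 2 by rewrite exprn_gt0.
have [m _ bm] : \forall m \near \oo, `|0 - b m| < eps ^+ 2.
  by move/cvgrPdist_lt : b0; apply.
exists (u m); exists m => // n /= mn; rewrite -ball_normE/=.
have := bm _ (leqnn m); rewrite sub0r normrN => {}bm.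
rewrite -(ltr_pXn2r (n := 2)) ?nnegrE ?(ltW eps0)//.
exact: le_lt_trans (ub _ _ mn) (le_lt_trans (ler_norm _) bm).
Qed.

Lemma cvg_ipl (u : nat -> V) (f v : V) :
  u n @[n --> \oo] --> f -> ip V (u n) v @[n --> \oo] --> ip V f v.
Proof.
move=> uf; apply/cvgrPdistC_le => eps eps0.
have v1 : 0 < `|v| + 1 by rewrite ltr_wpDl.
have : \forall n \near \oo, `|f - u n| <= eps / (`|v| + 1).
  by move/cvgrPdist_le : uf; apply; rewrite divr_gt0.
apply: filterS => n fn; rewrite -ipBl (le_trans (ip_le_norm _ _))// distrC.
rewrite (@le_trans _ _ (eps / (`|v| + 1) * (`|v| + 1)))//; last first.
  by rewrite divfK ?gt_eqF.
by rewrite ler_pM// lerDl.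
Qed.

(** Minimise J f = |f|^2 - 2 L f.  The parallelogram law makes a minimising
    sequence Cauchy, and comparing J at f and at f + t u shows that
    <f, u> - L u tends to 0 along it. *)
Lemma riesz_representation (L : V -> R) (C : R) :
  (forall u v, L (u + v) = L u + L v) -> (forall a u, L (a *: u) = a * L u) ->
  (forall u, `|L u| <= C * `|u|) -> exists h, forall u, L u = ip V u h.
Proof.
move=> LD LZ LC.
pose J (f : V) := ip V f f - 2 * L f.
have J_lb f : - C ^+ 2 <= J f.
  rewrite /J -ip_norm; have := le_trans (ler_norm _) (LC f).
  have := sqr_ge0 (`|f| - C); rewrite sqrrB; nra.
pose S := [set J f | f in [set: V]].
have hS : has_inf S.
  split; first by exists (J 0); exists 0.
  by exists (- C ^+ 2) => _ [f _ <-].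
pose j := inf S.
have jJ f : j <= J f by apply: ge_inf; [exact: hS.2|exists f].
have /choice[f fE] (n : nat) : exists f, J f < j + n.+1%:R^-1.
  have [|_ [f _ <-] fj] := @inf_adherent _ S n.+1%:R^-1 _ hS.
    by rewrite invr_gt0 ltr0n.
  by exists f.
have JZ (n : nat) u t : - n.+1%:R^-1 <= t ^+ 2 * ip V u u + 2 * t * (ip V (f n) u - L u).
  have := lt_le_trans (fE n) (lerD (jJ (f n + t *: u)) (lexx n.+1%:R^-1)).
  rewrite /J !(ipDl, ipDr, ipZl, ipZr) LD LZ (ipC u (f n)).
  move: (ip V (f n) u) (ip V u u) (ip V (f n) (f n)) (n.+1%:R^-1) (L u) (L (f n)).
  by move=> p q r b lu lf; nra.
have crit n u : (ip V (f n) u - L u) ^+ 2 <= ip V u u / n.+1%:R.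
  have [u0|u0] := eqVneq (ip V u u) 0.
    have -> : L u = 0.
      apply/eqP; rewrite -normr_le0 (le_trans (LC u))// (ip_eq0 u0).
      by rewrite normr0 mulr0.
    by rewrite (ip_eq0 u0) !ip0r subrr expr0n mul0r.
  have uu : 0 < ip V u u by rewrite lt_def u0 ip_ge0.
    (* This value of [t] minimises the quadratic polynomial in [JZ]. *)
have := JZ n u (- (ip V (f n) u - L u) / ip V u u).
  set x := ip V (f n) u - L u; set q := ip V u u in u0 uu *.
  have -> : (- x / q) ^+ 2 * q + 2 * (- x / q) * x = - (x ^+ 2 / q) by field.
  by rewrite lerN2 ler_pdivrMr// mulrC.
have Cau m n : (m <= n)%N -> `|f m - f n| ^+ 2 <= 4 * m.+1%:R^-1.
  move=> mn; rewrite ip_norm.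
  have := lerD (ltW (fE m)) (ltW (fE n)).
  have := jJ (2^-1 *: (f m + f n)).
  rewrite /J !(ipBl, ipBr, ipDl, ipDr, ipZl, ipZr) LZ LD (ipC (f n) (f m)).
  have nm : n.+1%:R^-1 <= m.+1%:R^-1 :> R.
    by rewrite lef_pV2 ?posrE ?ltr0n// ler_nat ltnS.
  move: nm; set a := n.+1%:R^-1; set b := m.+1%:R^-1.
  move: (ip V (f m) (f m)) (ip V (f m) (f n)) (ip V (f n) (f n)) => p q s.
  by move: (L (f m)) (L (f n)) => lm ln; lra.
have [h fh] : exists h : V, f n @[n --> \oo] --> h.
  apply: (cvg_of_dist2 Cau); rewrite -[X in _ --> X](mulr0 4); apply: cvgMl_tmp.
  exact: cvg_harmonic.
exists h => u; apply/eqP; rewrite -subr_eq0 -sqrf_eq0 eq_le sqr_ge0 andbT.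
have A : (L u - ip V (f n) u) ^+ 2 @[n --> \oo] --> (L u - ip V h u) ^+ 2.
  by apply: cvgM; (apply: cvgB; first exact: cvg_cst); exact: cvg_ipl.
have B : ip V u u * n.+1%:R^-1 @[n --> \oo] --> (0 : R).
  by rewrite -[X in _ --> X](mulr0 (ip V u u)); apply: cvgMl_tmp; exact: cvg_harmonic.
rewrite (ipC u h); apply: (ler_cvg_to A B).
by exists 0%N => // n _ /=; rewrite -sqrrN opprB; exact: crit.
Qed.

End hilbert.

(** * Orthonormal expansions *)
Section orthonormal_expansion.
Context {R : realType} {X : Type} (V : rkhs R X).
Variable e : nat -> V.
Hypothesis orthonormal_e : forall l m, ip V (e l) (e m) = (l == m)%:R.

Definition partial_sum (M : nat) (v : V) : V := \sum_(m < M) ip V v (e m) *: e m.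

Lemma ip_partial_sum M u v :
  ip V (partial_sum M u) (partial_sum M v) =
  \sum_(m < M) ip V u (e m) * ip V v (e m).
Proof.
rewrite ip_suml; apply: eq_bigr => l _; rewrite ipZl ip_sumr; congr (_ * _).
rewrite (sum_ord_single (ltn_ord l)) => [|m ml]; rewrite ipZr orthonormal_e/=.
  by rewrite eqxx mulr1.
by rewrite eq_sym (negPf ml) mulr0.
Qed.

Lemma ip_partial_sumr M u v :
  ip V u (partial_sum M v) = \sum_(m < M) ip V u (e m) * ip V v (e m).
Proof. by rewrite ip_sumr; apply: eq_bigr => m _; rewrite ipZr mulrC. Qed.

Lemma dist_partial_sum M v :
  `|v - partial_sum M v| ^+ 2 = `|v| ^+ 2 - \sum_(m < M) ip V v (e m) ^+ 2.
Proof.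
rewrite !ip_norm ipBl !ipBr ip_partial_sum (ipC (partial_sum _ _)).
by rewrite ip_partial_sumr subrr subr0.
Qed.

Lemma bessel M v : \sum_(m < M) ip V v (e m) ^+ 2 <= `|v| ^+ 2.
Proof. by rewrite -subr_ge0 -dist_partial_sum sqr_ge0. Qed.

Lemma norm_partial_sum M v : `|partial_sum M v| <= `|v|.
Proof.
rewrite -(ler_pXn2r (n := 2)) ?nnegrE// ip_norm ip_partial_sum.
exact: bessel.
Qed.


Definition total_family := forall v, (forall m, ip V v (e m) = 0) -> v = 0.

(** Bessel's inequality makes the partial sums Cauchy; their limit has the same
    coefficients as [v]. *)
Lemma cvg_partial_sum v : total_family -> partial_sum M v @[M --> \oo] --> v.
Proof.
move=> tot.
pose S M := \sum_(m < M) ip V v (e m) ^+ 2.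
have Snd : {homo S : m n / (m <= n)%N >-> m <= n}.
  move=> m n mn; rewrite /S -(subnKC mn) big_split_ord/= lerDl sumr_ge0// => i _.
  exact: sqr_ge0.
have Scv : S M @[M --> \oo] --> limn S.
  apply: nondecreasing_is_cvgn => //; exists (`|v| ^+ 2) => _ [M _ <-].
  exact: bessel.
have Sle M : S M <= limn S by apply: nondecreasing_cvgn_le => //; apply/cvg_ex; exists (limn S).
have [w vw] : exists w : V, partial_sum M v @[M --> \oo] --> w.
  apply: (@cvg_of_dist2 _ _ _ _ (fun M => limn S - S M)).
    move=> m n mn.
    have -> : `|partial_sum m v - partial_sum n v| ^+ 2 = S n - S m.
      have pm : ip V (partial_sum m v) (partial_sum n v) = S m.
        rewrite ip_suml; apply: eq_bigr => l _; rewrite ipZl.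
        rewrite ip_sumr (sum_ord_single (leq_trans (ltn_ord l) mn)) => [|k kl];
          rewrite ipZr orthonormal_e/=; first by rewrite eqxx mulr1 expr2.
        by rewrite eq_sym (negPf kl) mulr0.
      rewrite ip_norm ipBl !ipBr !ip_partial_sum (ipC (partial_sum n v)) pm.
      by rewrite subrr sub0r opprB.
    by rewrite lerD2r.
  rewrite -[X in _ --> X](subrr (limn S)); apply: cvgB => //; exact: cvg_cst.
suff vw_eq : v = w by rewrite [X in _ --> X]vw_eq.
apply/eqP; rewrite -subr_eq0; apply/eqP/tot => m.
rewrite ipBl; apply/eqP; rewrite subr_eq0; apply/eqP.
have := @cvg_ipl _ _ _ _ _ (e m) vw; apply: cvg_unique => //.
apply: cvg_near_cst; exists m.+1 => // M /= mM.
rewrite ipC ip_partial_sumr (sum_ord_single mM) => [|k kl]; rewrite orthonormal_e/=.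
  by rewrite eqxx mul1r.
by rewrite eq_sym (negPf kl) mul0r.
Qed.

Lemma cvg_ip_partial_sum u v : total_family ->
  \sum_(m < M) ip V u (e m) * ip V v (e m) @[M --> \oo] --> ip V u v.
Proof.
move=> /(@cvg_partial_sum u) /(@cvg_ipl _ _ _ _ _ v).
rewrite (_ : (fun M => ip V (partial_sum M u) v) =
  (fun M => \sum_(m < M) ip V u (e m) * ip V v (e m)))//.
apply/funext => M; rewrite ipC ip_partial_sumr.
by apply: eq_bigr => m _; rewrite mulrC.
Qed.

End orthonormal_expansion.

(** * The embedding into L2(nu) *)
Section l2_embedding.
Context d (X : measurableType d) {R : realType} (nu : probability X R)
  (V : rkhs R X).
Hypothesis embedV : compactly_embedded nu V.
Hypothesis mkdiag : measurable_fun [set: X] (fun x => rkernel V x x).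
Hypothesis trace_fin : (\int[nu]_x (rkernel V x x)%:E < +oo)%E.
Implicit Types f g : V.

Definition l2 f g := l2_ip nu (ev V f) (ev V g).

Lemma rkernelE x y : rkernel V x y = ip V (ksec V x) (ksec V y).
Proof. by rewrite /rkernel reproducing. Qed.

Lemma rkernel_ge0 x : 0 <= rkernel V x x.
Proof. by rewrite rkernelE ip_ge0. Qed.

Lemma evB f g : ev V f \- ev V g = ev V (f - g).
Proof. by rewrite linearB. Qed.

Lemma ev_sum I (s : seq I) (F : I -> V) (a : I -> R) x :
  ev V (\sum_(i <- s) a i *: F i) x = \sum_(i <- s) a i * ev V (F i) x.
Proof.
by rewrite reproducing ip_suml; apply: eq_bigr => i _; rewrite ipZl reproducing.
Qed.

Lemma measurable_ev f : measurable_fun [set: X] (ev V f).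
Proof. by have [/(_ f) + _ _] := embedV; rewrite inE => /andP[]; rewrite inE. Qed.

Lemma integrable_ev_mul f g :
  nu.-integrable [set: X] (EFin \o (fun x => ev V f x * ev V g x)).
Proof. by have [L2 _ _] := embedV; exact/Lfun1_integrable/Lfun2_mul_Lfun1. Qed.

Lemma l2C f g : l2 f g = l2 g f.
Proof. by apply: eq_Rintegral => x _; rewrite mulrC. Qed.

Lemma l2Dl f g h : l2 (f + g) h = l2 f h + l2 g h.
Proof.
rewrite /l2/= /l2_ip -RintegralD//; [|exact: integrable_ev_mul..].
by apply: eq_Rintegral => x _; rewrite !reproducing ipDl mulrDl.
Qed.

Lemma l2Zl a f h : l2 (a *: f) h = a * l2 f h.
Proof.
rewrite /l2/= /l2_ip -RintegralZl//; [|exact: integrable_ev_mul].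
by apply: eq_Rintegral => x _; rewrite !reproducing ipZl mulrA.
Qed.

Lemma l2_0l h : l2 0 h = 0.
Proof. by rewrite -(scale0r (0 : V)) l2Zl mul0r. Qed.

Lemma l2Zr a f h : l2 h (a *: f) = a * l2 h f.
Proof. by rewrite l2C l2Zl l2C. Qed.

Lemma l2Bl f g h : l2 (f - g) h = l2 f h - l2 g h.
Proof. by rewrite -scaleN1r l2Dl l2Zl mulN1r. Qed.

Lemma l2Br f g h : l2 h (f - g) = l2 h f - l2 h g.
Proof. by rewrite ![l2 h _]l2C l2Bl. Qed.

Lemma l2Dr f g h : l2 h (f + g) = l2 h f + l2 h g.
Proof. by rewrite ![l2 h _]l2C l2Dl. Qed.

Lemma l2_suml I (s : seq I) (F : I -> V) (a : I -> R) g :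
  l2 (\sum_(i <- s) a i *: F i) g = \sum_(i <- s) a i * l2 (F i) g.
Proof.
elim: s => [|i s IH]; last by rewrite !big_cons l2Dl l2Zl IH.
by rewrite !big_nil l2_0l.
Qed.

Lemma l2_ge0 f : 0 <= l2 f f.
Proof. by apply: Rintegral_ge0 => x _; rewrite -expr2 sqr_ge0. Qed.

Lemma l2E f g : (\int[nu]_x (ev V f x * ev V g x)%:E)%E = (l2 f g)%:E.
Proof.
rewrite /l2 /l2_ip /Rintegral fineK//.
exact: (integrable_fin_num measurableT (integrable_ev_mul f g)).
Qed.

Lemma integrable_rkernel_diag :
  nu.-integrable [set: X] (EFin \o (fun x => rkernel V x x)).
Proof.
apply/integrableP; split; first exact/measurable_EFinP.
by under eq_integral do rewrite /= ger0_norm ?rkernel_ge0//.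
Qed.

Definition trace : R := \int[nu]_x rkernel V x x.

Lemma abs_ev_le f x : `|ev V f x| <= `|f| * `|ksec V x|.
Proof. by rewrite reproducing; exact: ip_le_norm. Qed.

(** Bound both functions pointwise by |f(x)| <= |f| sqrt(k(x, x)). *)
Lemma l2_le_norm f g : `|l2 f g| <= trace * `|g| * `|f|.
Proof.
have int := integrable_ev_mul f g.
apply: (le_trans (le_normr_Rintegral measurableT int)).
have intk : nu.-integrable [set: X] (EFin \o (fun x => (`|g| * `|f|) * rkernel V x x)).
  rewrite (_ : _ \o _ = (fun x => (`|g| * `|f|)%:E * (rkernel V x x)%:E)%E).
    exact: (integrableZl measurableT _ integrable_rkernel_diag).
  by apply/funext => x /=; rewrite EFinM.
rewrite -mulrA [leRHS]mulrC -RintegralZl//; last exact: integrable_rkernel_diag.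
apply: le_Rintegral => //.
  have /integrableP[mint iint] := int.
  apply/integrableP; split.
    by apply/measurable_EFinP; apply: measurableT_comp => //; exact/measurable_EFinP.
  by under eq_integral do rewrite /= normr_id.
move=> x _; rewrite normrM rkernelE -ip_norm.
rewrite (mulrC `|g|) expr2 mulrACA; apply: ler_pM => //; exact: abs_ev_le.
Qed.

Lemma l2_eq0 f : l2 f f = 0 -> f = 0.
Proof.
move=> f0; have [_ + _] := embedV; apply.
have := l2E f f; rewrite f0.
under eq_integral do rewrite -(ger0_norm (x := _ * _)) -?expr2 ?sqr_ge0// -abse_EFin.
move/(ae_eq_integral_abs nu measurableT); have mf := measurable_ev f.
move=> /(_ _)/wrap[]; first by apply/measurable_EFinP; exact: measurable_funX.
by apply: filterS => x /(_ I) [] /eqP; rewrite sqrf_eq0 => /eqP.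
Qed.

Lemma Lnorm_ev f : 'N[nu]_2%:E[EFin \o ev V f]%E = (Num.sqrt (l2 f f))%:E.
Proof.
rewrite unlock; under eq_integral do
  rewrite abse_EFin poweR_EFin powR_mulrn// real_normK ?num_real// expr2.
by rewrite l2E poweR_EFin powR12_sqrt ?l2_ge0.
Qed.

(** Limits in L2(nu) of elements of V are handled through the bilinear form [l2]
    alone. *)
Lemma cvg_l2_evP (u : nat -> V) f :
  cvg_l2 nu (fun n => ev V (u n)) (ev V f) <->
  l2 (u n - f) (u n - f) @[n --> \oo] --> 0.
Proof.
rewrite /cvg_l2.
under eq_fun do rewrite evB Lnorm_ev.
split => [/fine_cvg cv|cv].
  have cv' : Num.sqrt (l2 (u n - f) (u n - f)) @[n --> \oo] --> 0 by [].
  rewrite -[X in _ --> X](mulr0 0).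
  rewrite (_ : (fun n => _) = (fun n => Num.sqrt (l2 (u n - f) (u n - f)) *
     Num.sqrt (l2 (u n - f) (u n - f)))); first exact: cvgM.
  by apply/funext => n; rewrite -expr2 sqr_sqrtr ?l2_ge0.
apply: cvg_EFin; first by near=> n.
rewrite -[X in _ --> X]sqrtr0.
by apply: continuous_cvg => //; exact: sqrt_continuous.
Unshelve. all: by end_near. Qed.

Lemma cvg_l2_of_norm (u : nat -> V) f :
  u n @[n --> \oo] --> f -> cvg_l2 nu (fun n => ev V (u n)) (ev V f).
Proof.
move=> uf; apply/cvg_l2_evP.
have nf : `|u n - f| @[n --> \oo] --> 0.
  rewrite -[X in _ --> X](normr0 V) -(subrr f); apply: cvg_norm.
  by apply: cvgB => //; exact: cvg_cst.
apply: (@squeeze_cvgr _ _ _ _ (fun=> 0) (fun n => trace * (`|u n - f| * `|u n - f|))).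
- near=> n; rewrite l2_ge0/= mulrA.
  exact: le_trans (ler_norm _) (l2_le_norm _ _).
- exact: cvg_cst.
- by rewrite -[X in _ --> X](mulr0 trace) -[X in trace * X](mulr0 0); apply: cvgMl_tmp; apply: cvgM.
Unshelve. all: by end_near. Qed.

Lemma l2_sqr_le f g : l2 g g = 1 -> l2 f g ^+ 2 <= l2 f f.
Proof.
move=> g1; have := l2_ge0 (f - l2 f g *: g).
rewrite l2Bl !l2Br !l2Zl !l2Zr g1 (l2C g f); nra.
Qed.

(** Continuity in L2(nu) of the coefficient along a unit vector. *)
Lemma cvg_l2_coef (u : nat -> V) f g : l2 g g = 1 ->
  cvg_l2 nu (fun n => ev V (u n)) (ev V f) ->
  l2 (u n) g @[n --> \oo] --> l2 f g.
Proof.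
move=> g1 /cvg_l2_evP uf.
have sq : (l2 (u n - f) g) ^+ 2 @[n --> \oo] --> 0.
  apply: (@squeeze_cvgr _ _ _ _ (fun=> 0) (fun n => l2 (u n - f) (u n - f))) => //.
  - by near=> n; rewrite sqr_ge0 l2_sqr_le.
  - exact: cvg_cst.
have : Num.sqrt ((l2 (u n - f) g) ^+ 2) @[n --> \oo] --> Num.sqrt 0.
  by apply: continuous_cvg => //; exact: sqrt_continuous.
rewrite sqrtr0.
under eq_fun do rewrite sqrtr_sqr l2Bl.
by move=> /norm_cvg0/cvg_sub0; apply; exact: cvg_cst.
Unshelve. all: by end_near. Qed.


Lemma cvg_l2_unique (u : nat -> V) f g :
  cvg_l2 nu (fun n => ev V (u n)) (ev V f) ->
  cvg_l2 nu (fun n => ev V (u n)) (ev V g) -> f = g.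
Proof.
move=> /cvg_l2_evP uf /cvg_l2_evP ug.
apply/eqP; rewrite -subr_eq0; apply/eqP/l2_eq0/eqP.
rewrite eq_le l2_ge0 andbT.
have h : 2 * (l2 (u n - f) (u n - f) + l2 (u n - g) (u n - g)) @[n --> \oo] --> 0.
  by rewrite -[X in _ --> X](mulr0 2) -(addr0 0); apply: cvgMl_tmp; apply: cvgD.
apply: (ler_cvg_to (cvg_cst _) h); near=> n.
have -> : f - g = (u n - g) - (u n - f) by rewrite opprB [RHS]addrC subrKA.
move: (u n - f) (u n - g) => v w; have := l2_ge0 (v + w).
by rewrite l2Bl !l2Br l2Dl !l2Dr (l2C w v); lra.
Unshelve. all: by end_near. Qed.

End l2_embedding.

(** * The eigenbasis of the integral operator *)
Section spectral.
Context d (X : measurableType d) {R : realType} (nu : probability X R)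
  (V : rkhs R X) (lam : nat -> R) (phi : nat -> V).
Hypothesis embedV : compactly_embedded nu V.
Hypothesis trace_fin : (\int[nu]_x (rkernel V x x)%:E < +oo)%E.
Hypothesis spec : spectral_decomposition nu lam phi.

Let lam_gt0 := spectral_pos spec.

Lemma measurable_rkernel_diag : measurable_fun [set: X] (fun x => rkernel V x x).
Proof.
apply: (@measurable_fun_cvg _ _ _ _
  (fun M x => \sum_(m < M) lam m * ev V (phi m) x * ev V (phi m) x)).
  move=> M; apply: measurable_sum => m.
  by apply: measurable_funM; [apply: measurable_funM|]; rewrite //;
    exact: (measurable_ev embedV _).
by move=> x _; exact: (spectral_kernel spec).
Qed.

Let mk := measurable_rkernel_diag.

(** Sigma is the adjoint of the embedding into L2(nu).  Riesz representation of
    u |-> (u, phi_l) gives an element h of V, whose values are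
    (k(x, .), phi_l) = (Sigma phi_l)(x); the spectral decomposition says that
    this function is lam_l phi_l in L2(nu), hence in V. *)
Lemma l2_phi u l : l2 nu u (phi l) = lam l * ip V u (phi l).
Proof.
have [h hE] : exists h, forall u, l2 nu u (phi l) = ip V u h.
  apply: (@riesz_representation _ _ _ _ (trace nu V * `|phi l|)).
  - by move=> f g; exact: (l2Dl embedV _ _ _).
  - by move=> a f; exact: (l2Zl embedV _ _ _).
  - by move=> f; exact: (l2_le_norm embedV mk trace_fin _ _).
have opE : integral_operator nu V (ev V (phi l)) = ev V h.
  by apply/funext => x; rewrite [RHS]reproducing ipC -hE.
have [L2 _ _] := embedV.
have := spectral_sum spec (L2 (phi l)); rewrite opE.
have -> : (fun M x => \sum_(m < M) lam m * l2_ip nu (ev V (phi m)) (ev V (phi l)) *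
      ev V (phi m) x) =
    (fun M => ev V (\sum_(m < M) (lam m * (m == l :> nat)%:R) *: phi m)).
  apply/funext => M; apply/funext => x; rewrite ev_sum.
  by apply: eq_bigr => m _; rewrite (spectral_orthonormal spec).
move=> cv.
have cv2 : cvg_l2 nu (fun M => ev V (\sum_(m < M) (lam m * (m == l :> nat)%:R) *: phi m))
    (ev V (lam l *: phi l)).
  apply: (cvg_l2_of_norm embedV mk trace_fin).
  apply: cvg_near_cst; exists l.+1 => // M /= lM.
  rewrite (sum_ord_single lM) /= ?eqxx ?mulr1// => k /negPf ->.
  by rewrite mulr0 scale0r.
by rewrite hE (cvg_l2_unique embedV cv cv2) ipZr.
Qed.

(** The eigenfunctions normalised in V, where phi_m has squared norm
    1 / lam_m. *)
Definition eigenbasis m : V := Num.sqrt (lam m) *: phi m.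
Local Notation e := eigenbasis.

Lemma sqrt_lam_gt0 m : 0 < Num.sqrt (lam m).
Proof. by rewrite sqrtr_gt0. Qed.

Lemma sqr_sqrt_lam m : Num.sqrt (lam m) * Num.sqrt (lam m) = lam m.
Proof. by rewrite -expr2 sqr_sqrtr// ltW. Qed.

Lemma ip_phi l m : ip V (phi l) (phi m) = (l == m)%:R / lam m.
Proof.
apply: (mulfI (lt0r_neq0 (lam_gt0 m))).
rewrite -l2_phi mulrC divfK ?lt0r_neq0//.
exact: (spectral_orthonormal spec l m).
Qed.

Lemma orthonormal_eigenbasis l m : ip V (e l) (e m) = (l == m)%:R.
Proof.
rewrite ipZl ipZr ip_phi; have [->|_] := eqVneq l m; last by rewrite mul0r !mulr0.
by rewrite mulrA sqr_sqrt_lam mul1r divff// lt0r_neq0.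
Qed.

Lemma ev_eigenbasis m x : ip V (ksec V x) (e m) = Num.sqrt (lam m) * ev V (phi m) x.
Proof. by rewrite ipZr ipC reproducing. Qed.

Lemma l2_eigenbasis l m : l2 nu (e l) (e m) = (l == m)%:R * lam m.
Proof.
by rewrite (l2Zr embedV) l2_phi mulrCA -ipZr orthonormal_eigenbasis mulrC.
Qed.

(** The pointwise expansion of k(x, x) is Parseval's identity for k(x, .), so
    k(x, .) is the limit of its partial sums, and a vector orthogonal to all the
    basis vectors vanishes at every x. *)
Lemma total_eigenbasis : total_family e.
Proof.
move=> v v0; apply: (@ev_inj _ _ V); rewrite linear0; apply/funext => x /=.
apply/eqP; rewrite -sqrf_eq0 eq_le sqr_ge0 andbT.
pose r M := `|v| ^+ 2 * `|ksec V x - partial_sum e M (ksec V x)| ^+ 2.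
have r0 : r M @[M --> \oo] --> 0.
  suff d0 : `|ksec V x - partial_sum e M (ksec V x)| ^+ 2 @[M --> \oo] --> 0.
    by rewrite -(mulr0 (`|v| ^+ 2)); apply: cvgMl_tmp.
  under eq_fun do rewrite (dist_partial_sum orthonormal_eigenbasis).
  rewrite -[X in nbhs X](subrr (`|ksec V x| ^+ 2)); apply: cvgB; first exact: cvg_cst.
  rewrite ip_norm -rkernelE.
  have := spectral_kernel spec (x := x) (y := x).
  rewrite (_ : (fun M => \sum_(m < M) lam m * ev V (phi m) x * ev V (phi m) x) =
    (fun M => \sum_(m < M) ip V (ksec V x) (e m) ^+ 2))//.
  apply/funext => M; apply: eq_bigr => m _.
  by rewrite ev_eigenbasis exprMn sqr_sqrtr ?(ltW (lam_gt0 _))// -mulrA expr2.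
apply: (ler_cvg_to (cvg_cst _) r0); exists 0%N => // M _ /=.
have -> : ev V v x = ip V v (ksec V x - partial_sum e M (ksec V x)).
  rewrite reproducing ipBr ip_partial_sumr big1 ?subr0// => m _.
  by rewrite v0 mul0r.
by rewrite /r -exprMn -[leLHS]real_normK ?num_real// ler_pXn2r ?nnegrE ?mulr_ge0// ip_le_norm.
Qed.

Definition power_series p v M : V :=
  \sum_(l < M) (lam l `^ p * l2 nu v (phi l)) *: phi l.

Lemma power_seriesE p v :
  (fun M x => \sum_(l < M) lam l `^ p * l2_ip nu (ev V v) (ev V (phi l)) * ev V (phi l) x)
  = (fun M => ev V (power_series p v M)).
Proof. by apply/funext => M; apply/funext => x; rewrite ev_sum. Qed.

Lemma l2_phi_phi l m : l2 nu (phi l) (phi m) = (l == m)%:R.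
Proof. exact: (spectral_orthonormal spec l m). Qed.

Lemma power_series_coef p v w m :
  cvg_l2 nu (fun M => ev V (power_series p v M)) (ev V w) ->
  l2 nu w (phi m) = lam m `^ p * l2 nu v (phi m).
Proof.
have m1 : l2 nu (phi m) (phi m) = 1 by rewrite l2_phi_phi eqxx.
move=> /(cvg_l2_coef embedV m1) cv; apply: (cvg_unique _ cv) => //.
apply: cvg_near_cst; exists m.+1 => // M /= mM.
rewrite (l2_suml embedV) (sum_ord_single mM) => [|k /negPf km]; rewrite l2_phi_phi/=.
  by rewrite eqxx mulr1.
by rewrite km mulr0.
Qed.

(** Well-definedness: the embedding into L2(nu) is injective. *)
Lemma spectral_powerE p v w :
  cvg_l2 nu (fun M => ev V (power_series p v M)) (ev V w) ->
  spectral_power nu lam phi p v = w.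
Proof.
move=> vw; rewrite /spectral_power power_seriesE.
by case: xgetP => [w' _ /(cvg_l2_unique embedV vw) //|/(_ w)].
Qed.

(** Sigma^(-1/2) inverts Sigma^(1/2) on its range: the series that defines
    Sigma^(-1/2) v is the expansion of the preimage, so it has a limit in V, and
    the coefficients of v can be read from this limit. *)
Lemma spectral_power_inv_coef v m :
  range (spectral_power nu lam phi 2^-1) v ->
  ip V v (e m) =
  Num.sqrt (lam m) * ip V (spectral_power nu lam phi (- 2^-1) v) (e m).
Proof.
move=> [w0 _ v_def].
have [w vw] : exists w, cvg_l2 nu (fun M => ev V (power_series (- 2^-1) v M)) (ev V w).
  move: v_def; rewrite /spectral_power power_seriesE.
  case: xgetP => [w -> w0v wv|_ v0]; last first.
    (* No element of V is the sum of the series, and v is the default 0. *)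
    exists 0; apply: (cvg_l2_of_norm embedV mk trace_fin).
    apply: cvg_near_cst; exists 0%N => // M _.
    by rewrite /power_series -v0 big1// => l _; rewrite (l2_0l embedV) mulr0 scale0r.
  exists w0; have := cvg_partial_sum orthonormal_eigenbasis (v := w0) total_eigenbasis.
  move=> /(cvg_l2_of_norm embedV mk trace_fin).
  rewrite (_ : (fun M => ev V (partial_sum e M w0)) =
    (fun M => ev V (power_series (- 2^-1) v M)))//.
  apply/funext => M; congr (ev V _); apply: eq_bigr => l _.
  rewrite -wv (power_series_coef l w0v) mulrA -powRD; last first.
    by rewrite (gt_eqF (lam_gt0 l)) implybT.
  rewrite addrC subrr powRr0 mul1r l2_phi ipZr scalerA.
  by rewrite mulrAC sqr_sqrt_lam mulrC.
rewrite (spectral_powerE vw).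
have := power_series_coef m vw; rewrite !l2_phi mulrCA.
move=> /(mulfI (lt0r_neq0 (lam_gt0 m))) wE.
rewrite !ipZr wE powRN powR12_sqrt ?(ltW (lam_gt0 _))//.
by rewrite mulVKf ?lt0r_neq0 ?sqrt_lam_gt0.
Qed.

(** On the span of the first n eigenfunctions Sigma^(-1/2) multiplies the
    coordinate along phi_i by lam_i^(-1/2), which is largest for the last one. *)
Lemma smoothness_const_eigenspace n : (0 < n)%N ->
  (smoothness_const nu lam phi (linear_span (fun i : 'I_n => phi i)) ^+ 2
   = ((lam n.-1)^-1)%:E)%E.
Proof.
move=> n0.
have powE (a : 'I_n -> R) :
    spectral_power nu lam phi (- 2^-1) (\sum_(i < n) a i *: phi i) =
    \sum_(i < n) (a i / Num.sqrt (lam i)) *: phi i.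
  apply: spectral_powerE; apply: (cvg_l2_of_norm embedV mk trace_fin).
  apply: cvg_near_cst; exists n => // M /= nM.
  (* The terms of the series, with [a] extended by zero beyond [n]. *)
  pose F l : V := if insub l is Some i then
    (a i / Num.sqrt (lam l)) *: phi l else 0.
  have FE (l : nat) :
      (lam l `^ (- 2^-1) * l2 nu (\sum_(i < n) a i *: phi i) (phi l)) *: phi l = F l.
    rewrite /F (l2_suml embedV) powRN powR12_sqrt ?(ltW (lam_gt0 _))//.
    case: insubP => [i _ il|]; last first.
      rewrite -leqNgt => nl; rewrite big1 ?mulr0 ?scale0r// => i _.
      by rewrite l2_phi_phi (ltn_eqF (leq_trans (ltn_ord i) nl)) mulr0.
    rewrite (sum_ord_single (ltn_ord i)) => [|k ki]; rewrite l2_phi_phi -il/=.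
      rewrite eqxx mulr1 mulrC; congr (a _ / _ *: _); exact: val_inj.
    by rewrite (negPf ki) mulr0.
  rewrite /power_series (eq_bigr (fun l : 'I_M => F l)) => [|l _]; last exact: FE.
  rewrite -(subnKC nM) big_split_ord/= [X in _ + X]big1 ?addr0 => [|i _]; last first.
    by rewrite /F insubN// -leqNgt leq_addr.
  by apply: eq_bigr => i _; rewrite /F valK.
have normE (a : 'I_n -> R) :
    `|\sum_(i < n) a i *: phi i| ^+ 2 = \sum_(i < n) a i ^+ 2 / lam i.
  rewrite ip_norm ip_suml; apply: eq_bigr => i _; rewrite ipZl ip_sumr.
  rewrite (sum_ord_single (ltn_ord i)) => [|k ki]; rewrite ipZr ip_phi/=.
    by rewrite eqxx mul1r mulrA expr2; congr (_ * a _ / _); exact: val_inj.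
  by rewrite eq_sym (negPf ki) mul0r mulr0.
pose c := (Num.sqrt (lam n.-1))^-1.
have c0 : 0 < c by rewrite invr_gt0 sqrt_lam_gt0.
have c2 : c ^+ 2 = (lam n.-1)^-1 by rewrite exprVn sqr_sqrtr ?(ltW (lam_gt0 _)).
suff -> : smoothness_const nu lam phi (linear_span (fun i : 'I_n => phi i)) = c%:E.
  by rewrite -EFin_expe c2.
apply/eqP; rewrite eq_le; apply/andP; split.
  apply: ub_ereal_sup => _ [v [[a _ <-] /eqP v0] <-].
  rewrite lee_fin ler_pdivrMr ?normr_gt0// powE.
  rewrite -(ler_pXn2r (n := 2)) ?nnegrE ?mulr_ge0 ?(ltW c0)// exprMn !normE c2.
  rewrite mulr_sumr; apply: ler_sum => i _.
  rewrite expr_div_n sqr_sqrtr ?(ltW (lam_gt0 _))// [leRHS]mulrC ler_wpM2l//.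
    by rewrite divr_ge0 ?sqr_ge0 ?(ltW (lam_gt0 _)).
  rewrite lef_pV2 ?posrE//; apply: (spectral_nonincreasing spec).
  by rewrite -ltnS prednK.
apply: ereal_sup_ubound.
have ln : (n.-1 < n)%N by rewrite prednK.
pose a (i : 'I_n) : R := (i == n.-1 :> nat)%:R.
have aE (b : 'I_n -> R) : \sum_(i < n) (a i * b i) *: phi i = b (Ordinal ln) *: phi n.-1.
  rewrite (sum_ord_single ln) /a/= ?eqxx ?mul1r// => k /negPf ->.
  by rewrite mul0r scale0r.
have phiE : \sum_(i < n) a i *: phi i = phi n.-1.
  by have := aE (fun=> 1); rewrite scale1r => <-; apply: eq_bigr => i _; rewrite mulr1.
have p0 : `|phi n.-1| != 0.
  rewrite -sqrf_eq0 ip_norm ip_phi eqxx mul1r invr_eq0; exact: lt0r_neq0.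
exists (phi n.-1).
  split; first by exists a.
  by move=> /= p00; rewrite p00 normr0 eqxx in p0.
congr EFin; rewrite -{1}phiE powE (aE (fun i => (Num.sqrt (lam i))^-1)).
by rewrite normrZ gtr0_norm// mulfK.
Qed.

End spectral.

(** * Integration over independent points *)
Section lower_integral.
Context d (T : measurableType d) {R : realType} (mu : {measure set T -> \bar R}).

(** The integral of a nonnegative function is a supremum over simple functions
    below it, hence is monotone also for functions that are not measurable.
    The event that a sample is unstable involves a supremum over all vectors of a
    subspace; this lemma handles it without a proof that it is measurable. *)
Lemma lower_integral_le (f g : T -> \bar R) :
  (forall x, 0 <= f x)%E -> (forall x, f x <= g x)%E ->
  (\int[mu]_x f x <= \int[mu]_x g x)%E.
Proof.
move=> f0 fg; rewrite !ge0_integralTE//; last by move=> x; exact: le_trans (f0 x) (fg x).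
apply: le_ereal_sup => _ [h hf <-]; exists h => // x.
exact: le_trans (hf x) (fg x).
Qed.

End lower_integral.

Section power_integral.
Context d (X : measurableType d) {R : realType} (nu : probability X R).

Lemma measurable_prod_tnth n (f : 'I_n -> X -> R) :
  (forall i, measurable_fun [set: X] (f i)) ->
  measurable_fun [set: n.-tuple X] (fun x => \prod_(i < n) f i (tnth x i)).
Proof.
move=> mf; apply: measurable_prod => i _.
by apply: measurableT_comp => //; exact: measurable_tnth.
Qed.

Lemma integral_prod_tnth n (f : 'I_n -> X -> R) :
  (forall i, nu.-integrable [set: X] (EFin \o f i)) ->
  (power_probability nu n).-integrable [set: n.-tuple X]
    (EFin \o (fun x => \prod_(i < n) f i (tnth x i))) /\
  (\int[power_probability nu n]_x (\prod_(i < n) f i (tnth x i))%:E =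
    (\prod_(i < n) \int[nu]_x f i x)%:E)%E.
Proof.
elim: n f => [|n IH] f intf.
  split.
    rewrite (_ : _ \o _ = cst 1%E); last by apply/funext => x /=; rewrite big_ord0.
    exact: finite_measure_integrable_cst.
  under eq_integral do rewrite big_ord0.
  by rewrite big_ord0 integral_cst//= probability_setT mule1.
have mf i : measurable_fun [set: X] (f i).
  by have /integrableP[/measurable_EFinP] := intf i.
have [] := IH (fun i => f (lift ord0 i)) (fun i => intf _).
set g := fun y : n.-tuple X => \prod_(i < n) f (lift ord0 i) (tnth y i).
move=> intg gE.
have mg : measurable_fun [set: n.-tuple X] g.
  by apply: (@measurable_prod_tnth n (fun i => f (lift ord0 i))) => i; exact: mf.
set P := power_probability nu n in intg gE *.
pose F (p : X * n.-tuple X) := f ord0 p.1 * g p.2.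
have mF : measurable_fun [set: X * n.-tuple X] (EFin \o F).
  apply/measurable_EFinP; apply: measurable_funM.
    exact: measurableT_comp.
  exact: measurableT_comp.
have intF : (nu \x P)%E.-integrable [set: X * n.-tuple X] (EFin \o F).
  apply/integrable12ltyP => //.
  have G0 : (0 <= \int[P]_y `|(g y)%:E|)%E by exact: integral_ge0.
  rewrite (_ : (fun x => _) = (fun x => `|(f ord0 x)%:E| * \int[P]_y `|(g y)%:E|)%E).
    rewrite ge0_integralZr//; last first.
      by apply: measurableT_comp => //; exact/measurable_EFinP.
    have /integrableP[_ f0oo] := intf ord0.
    have /integrableP[_ goo] := intg.
    by apply: lte_mul_pinfty; rewrite ?ge0_fin_numE ?integral_ge0 //.
  apply/funext => x; rewrite -ge0_integralZl//; last first.
    by apply: measurableT_comp => //; exact/measurable_EFinP.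
  by apply: eq_integral => y _; rewrite /F /= normrM EFinM.
set h := fun x : n.+1.-tuple X => \prod_(i < n.+1) f i (tnth x i).
have mh : measurable_fun [set: n.+1.-tuple X] (EFin \o h).
  by apply/measurable_EFinP; exact: measurable_prod_tnth.
have hF : (EFin \o h) \o @cons_pair _ X n = EFin \o F.
  apply/funext => -[x y]; rewrite /h /F /g /= big_ord_recl; congr (_ * _)%:E.
  by apply: eq_bigr => i _; rewrite tnthS.
split.
  apply/integrableP; split => //=.
  have /integrableP[_] := intF; apply: le_lt_trans.
  rewrite ge0_integral_distribution//; last by apply: (measurableT_comp (f := abse) _ mh).
  by apply: lower_integral_le => // p; have /(congr1 (fun q => q p))/= [->] := hF.
rewrite /= (integral_distribution mh) hF//.
rewrite -(integral12_prod_meas1 intF) /fubini_F.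
rewrite big_ord_recl EFinM.
under eq_integral => x _.
  rewrite /F/=.
  under eq_integral do rewrite EFinM.
  rewrite (integralZl measurableT intg) gE.
  over.
rewrite (integralZr measurableT (intf ord0)).
by rewrite /Rintegral fineK//; exact: (integrable_fin_num measurableT (intf ord0)).
Qed.

End power_integral.

(** * Integrals of Gram determinants of random vectors *)
Section truncated_gram.
Context {R : realType} {X : Type} (V : rkhs R X) (e : nat -> V).
Hypothesis orthonormal_e : forall l m, ip V (e l) (e m) = (l == m)%:R.
Variables (N : nat) (a : 'I_N -> V).

(** The Gram matrix of the projections of the [a i] onto the span of
    [e 0, ..., e M.-1]. *)
Definition truncated_gram (M : nat) : 'M[R]_N :=
  \matrix_(i, j) \sum_(m < M) ip V (a i) (e m) * ip V (a j) (e m).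

Lemma cvg_det_truncated_gram : total_family e ->
  \det (truncated_gram M) @[M --> \oo] --> \det (gram a).
Proof.
move=> tot; rewrite /determinant.
apply: cvg_big => [|s _]; first exact: add_continuous.
apply: cvgMl_tmp.
apply: cvg_big => [|i _]; first exact: mul_continuous.
rewrite mxE; under eq_fun do rewrite mxE.
exact: cvg_ip_partial_sum.
Qed.

(** Estimate each of the [N`!] products in the Leibniz formula by Cauchy-Schwarz.
    The bound does not depend on [M]: it is the dominating function below. *)
Lemma det_truncated_gram_le M :
  `|\det (truncated_gram M)| <= N`!%:R * \prod_(i < N) `|a i| ^+ 2.
Proof.
apply: (le_trans (ler_norm_sum _ _ _)).
apply: (@le_trans _ _ (\sum_(s : 'S_N) \prod_(i < N) `|a i| ^+ 2)); last first.
  by rewrite sumr_const card_Sn mulr_natl.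
apply: ler_sum => s _; rewrite normrM normr_sign mul1r normr_prod.
have -> : \prod_(i < N) `|a i| ^+ 2 = \prod_(i < N) (`|a i| * `|a (s i)|).
  rewrite [RHS]big_split/= [X in _ * X](_ : _ = \prod_(i < N) `|a i|).
    by rewrite -big_split/=; apply: eq_bigr => i _; rewrite expr2.
  by rewrite [RHS](reindex_inj (@perm_inj _ s)).
apply: ler_prod => i _; rewrite normr_ge0/= mxE.
rewrite -(ip_partial_sum orthonormal_e).
apply: (le_trans (ip_le_norm _ _)).
by apply: ler_pM => //; exact: norm_partial_sum.
Qed.

End truncated_gram.

(** The hypothesis [moments] expresses the independence of the vectors [a x i]:
    the joint moments of their coordinates are products of the second moments
    [G i].  A vector that does not depend on [x] also satisfies it. *)
Section expected_determinant.
Context d (T : measurableType d) {R : realType} (P : probability T R).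
Context {X : Type} (V : rkhs R X) (e : nat -> V).
Hypothesis orthonormal_e : forall l m, ip V (e l) (e m) = (l == m)%:R.
Hypothesis total_e : total_family e.
Variables (N : nat) (a : T -> 'I_N -> V) (G : 'I_N -> nat -> nat -> R).
Hypothesis moments : forall p q : 'I_N -> nat,
  P.-integrable [set: T] (EFin \o
    (fun x => \prod_(i < N) (ip V (a x i) (e (p i)) * ip V (a x i) (e (q i))))) /\
  (\int[P]_x (\prod_(i < N) (ip V (a x i) (e (p i)) * ip V (a x i) (e (q i))))%:E
    = (\prod_(i < N) G i (p i) (q i))%:E)%E.
Hypothesis G_trig : forall (i j : 'I_N) p q, (j < i)%N -> p != q -> G i p q = 0.
Hypothesis norm_integrable :
  P.-integrable [set: T] (EFin \o (fun x => \prod_(i < N) `|a x i| ^+ 2)).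

Lemma integral_det_truncated_gram M :
  P.-integrable [set: T] (EFin \o (fun x => \det (truncated_gram e (a x) M))) /\
  (\int[P]_x (\det (truncated_gram e (a x) M))%:E =
   (\sum_(u : {ffun 'I_N -> 'I_M} | injectiveb u) \prod_i G i (u i) (u i))%:E)%E.
Proof.
pose F (u : {ffun 'I_N -> 'I_M}) (s : 'S_N) x := (((-1) ^+ s)%:E *
  (\prod_(i < N) (ip V (a x i) (e (u i)) * ip V (a x i) (e (u (s i)))))%:E)%E.
have intF u s : P.-integrable [set: T] (F u s).
  exact: (integrableZl measurableT _ (moments (fun i => u i) (fun i => u (s i))).1).
have FE x : (\det (truncated_gram e (a x) M))%:E =
    (\sum_(u : {ffun 'I_N -> 'I_M}) \sum_(s : 'S_N) F u s x)%E.
  rewrite det_sum_prod -sumEFin; apply: eq_bigr => u _.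
  by rewrite -sumEFin; apply: eq_bigr => s _; rewrite /F -EFinM.
have -> : EFin \o (fun x => \det (truncated_gram e (a x) M)) =
    (fun x => \sum_(u : {ffun 'I_N -> 'I_M}) \sum_(s : 'S_N) F u s x)%E.
  by apply/funext => x /=; exact: FE.
split.
  by apply: integrable_sum => // u _; apply: integrable_sum.
under eq_integral do rewrite FE.
rewrite integral_sum//; last by move=> u; apply: integrable_sum.
rewrite -(sum_sign_prod_trig (G := fun i p q => G i p q)); last first.
  by move=> i j p q ji pq; apply: (G_trig ji).
rewrite -sumEFin; apply: eq_bigr => u _.
rewrite integral_sum// -sumEFin; apply: eq_bigr => s _.
have [mi mE] := moments (fun i => u i) (fun i => u (s i)).
by rewrite /F (integralZl measurableT mi) mE EFinM.
Qed.

Lemma integral_det_gram :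
  P.-integrable [set: T] (EFin \o (fun x => \det (gram (a x)))) /\
  \sum_(u : {ffun 'I_N -> 'I_M} | injectiveb u) \prod_i G i (u i) (u i) @[M --> \oo]
    --> \int[P]_x \det (gram (a x)).
Proof.
pose f_ M x := (\det (truncated_gram e (a x) M))%:E.
pose f x := (\det (gram (a x)))%:E.
have mf_ M : measurable_fun [set: T] (f_ M).
  by have [/integrableP[]] := integral_det_truncated_gram M.
have cvf x : f_ ^~ x @ \oo --> f x.
  apply: cvg_EFin; first by near=> M.
  exact: cvg_det_truncated_gram.
have mf : measurable_fun [set: T] f.
  by apply: (emeasurable_fun_cvg f_) => // x _; exact: cvf.
have intg : P.-integrable [set: T]
    (fun x => (N`!%:R)%:E * (\prod_(i < N) `|a x i| ^+ 2)%:E)%E.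
  exact: (integrableZl measurableT _ norm_integrable).
have [] := dominated_convergence measurableT mf_ mf _ intg _.
- by apply: aeW => x _; exact: cvf.
- by apply: aeW => x M _; rewrite -EFinM lee_fin det_truncated_gram_le.
move=> intf _ cv; split => //.
have fE : (\int[P]_x f x = (\int[P]_x \det (gram (a x)))%:E)%E.
  by rewrite /Rintegral fineK//; exact: (integrable_fin_num measurableT intf).
rewrite fE in cv.
have cv' : (\sum_(u : {ffun 'I_N -> 'I_M} | injectiveb u) \prod_i G i (u i) (u i))%:E
    @[M --> \oo] --> (\int[P]_x \det (gram (a x)))%:E.
  rewrite (_ : (fun M => _) = (fun M => \int[P]_x f_ M x)%E)//.
  by apply/funext => M; have [_ <-] := integral_det_truncated_gram M.
exact: (fine_cvg cv').
Unshelve. all: by end_near. Qed.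

End expected_determinant.

(** * Stability of a sample and residuals of a frame *)
Section stability.
Context {R : realType} {X : Type} (V : rkhs R X).

Lemma sum_cauchy_schwarz n (a b : 'I_n -> R) :
  (\sum_i a i * b i) ^+ 2 <= (\sum_i a i ^+ 2) * (\sum_i b i ^+ 2).
Proof.
set S := \sum_i a i * b i; set A := \sum_i a i ^+ 2; set B := \sum_i b i ^+ 2.
have A0 : 0 <= A by apply: sumr_ge0 => i _; exact: sqr_ge0.
have B0 : 0 <= B by apply: sumr_ge0 => i _; exact: sqr_ge0.
have H : 0 <= B * (A * B - S ^+ 2).
  have -> : B * (A * B - S ^+ 2) = \sum_i (B * a i - S * b i) ^+ 2.
    transitivity (\sum_i (B ^+ 2 * a i ^+ 2 - 2 * B * S * (a i * b i) + S ^+ 2 * b i ^+ 2)).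
      by rewrite big_split/= sumrB -!mulr_sumr -/A -/S -/B; ring.
    by apply: eq_bigr => i _; ring.
  by apply: sumr_ge0 => i _; exact: sqr_ge0.
have [B1|B1] := eqVneq B 0.
  have b0 i : b i = 0.
    apply/eqP; rewrite -sqrf_eq0; apply/eqP.
    move/eqP : B1; rewrite psumr_eq0 => [|j _]; last exact: sqr_ge0.
    by move=> /allP/(_ i)/= /[!mem_index_enum]/(_ isT)/eqP.
  by rewrite /S big1 ?expr0n ?mulr_ge0// => i _; rewrite b0 mulr0.
by rewrite pmulr_rge0 ?subr_ge0// lt_def B1 B0 in H.
Qed.

(** Gram-Schmidt, where a vector that depends on the previous ones contributes
    0: this family reproduces the span as an orthonormal basis does, without a
    count of its nonzero members. *)
Lemma parseval_frame n (b : 'I_n -> V) :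
  exists f : 'I_n -> V, (forall i, linear_span b (f i)) /\
    forall v, linear_span b v -> v = \sum_i ip V v (f i) *: f i.
Proof.
elim: n b => [|n IH] b.
  by exists b; split => [[]//|v [c _ <-]]; rewrite !big_ord0.
pose b' j := b (lift ord0 j).
have [f [fb fE]] := IH b'.
have [p [pb orth]] := span_orth_exists b' (b ord0).
have sub v : linear_span b' v -> linear_span b v.
  move=> [c _ <-]; exists (fun i => if unlift ord0 i is Some j then c j else 0) => //.
  rewrite big_ord_recl unlift_none scale0r add0r.
  by apply: eq_bigr => i _; rewrite liftK.
have [cp _ cpE] := pb.
pose r := b ord0 - p.
pose k := `|r|^-1.
exists (vcons (k *: r) f); split.
  move=> i; case: (unliftP ord0 i) => [j|] ->; first by rewrite vconsS; exact: sub.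
  rewrite vcons0; exists (fun i => if unlift ord0 i is Some j then - (k * cp j) else k) => //.
  rewrite big_ord_recl unlift_none /r -cpE scalerBr scaler_sumr -sumrN; congr (_ + _).
  by apply: eq_bigr => j _; rewrite liftK scaleNr scalerA.
move=> _ [c _ <-].
have b0E : b ord0 = r + p by rewrite /r subrK.
pose v' := c ord0 *: p + \sum_(i < n) c (lift ord0 i) *: b' i.
have v'b : linear_span b' v'.
  exists (fun i => c ord0 * cp i + c (lift ord0 i)) => //.
  under eq_bigr do rewrite scalerDl -scalerA.
  by rewrite big_split/= -scaler_sumr cpE.
have -> : \sum_(i < n.+1) c i *: b i = c ord0 *: r + v'.
  by rewrite big_ord_recl {1}b0E scalerDr -addrA.
rewrite big_ord_recl vcons0; congr (_ + _).
  rewrite ipZr ipDl ipZl (ipC v') (orth _ v'b : ip V r v' = 0) addr0 scalerA.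
  have [r0|r0] := eqVneq `|r| 0; first by rewrite (normr0_eq0 r0) !scaler0.
  by congr (_ *: _); rewrite -ip_norm /k; field.
rewrite [LHS]fE//; apply: eq_bigr => i _; rewrite vconsS (ipDl (c ord0 *: r) v') ipZl.
by rewrite (orth _ (fb i) : ip V r (f i) = 0) mulr0 add0r.
Qed.

Lemma parseval_norm n (b f : 'I_n -> V) v :
  (forall v, linear_span b v -> v = \sum_i ip V v (f i) *: f i) ->
  linear_span b v -> `|v| ^+ 2 = \sum_i ip V v (f i) ^+ 2.
Proof.
move=> fE bv; rewrite ip_norm {2}(fE v bv) ip_sumr.
by apply: eq_bigr => i _; rewrite ipZr expr2.
Qed.

Lemma parseval_le1 n (b f : 'I_n -> V) i :
  (forall v, linear_span b v -> v = \sum_i ip V v (f i) *: f i) ->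
  linear_span b (f i) -> `|f i| <= 1.
Proof.
move=> fE bf; have := parseval_norm fE bf; rewrite (bigD1 i)//= -ip_norm => H.
have [f0|f0] := eqVneq `|f i| 0; first by rewrite f0.
have f2 : 0 < `|f i| ^+ 2 by rewrite exprn_gt0// lt_def f0 normr_ge0.
have : `|f i| ^+ 2 * `|f i| ^+ 2 <= `|f i| ^+ 2 * 1.
  by rewrite mulr1 -expr2 [leRHS]H lerDl sumr_ge0// => j _; exact: sqr_ge0.
by rewrite ler_pM2l// expr_le1.
Qed.

(** With r = v - P v and r_i = f_i - P f_i, the squared norm of r is
    <r, v> = sum_i <v, f_i> <r, r_i>; then apply Cauchy-Schwarz twice. *)
Lemma residual_le_frame n m (b f : 'I_n -> V) (a : 'I_m -> V) v :
  (forall v, linear_span b v -> v = \sum_i ip V v (f i) *: f i) ->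
  linear_span b v ->
  `|v - orth_proj (linear_span a) v| ^+ 2 <=
  `|v| ^+ 2 * \sum_i `|f i - orth_proj (linear_span a) (f i)| ^+ 2.
Proof.
move=> fE bv; have [pv ov] := orth_projP a v.
set r := v - _ in ov *.
have rr : `|r| ^+ 2 = \sum_i ip V v (f i) * ip V r (f i - orth_proj (linear_span a) (f i)).
  have -> : `|r| ^+ 2 = ip V r v.
    by rewrite ip_norm {2}/r ipBr (ov _ pv) subr0.
  rewrite {1}(fE v bv) ip_sumr; apply: eq_bigr => i _; rewrite ipZr ipBr.
  by have [pf _] := orth_projP a (f i); rewrite (ov _ pf) subr0.
set s := \sum_i _ ^+ 2.
have : (`|r| ^+ 2) ^+ 2 <= `|v| ^+ 2 * (`|r| ^+ 2 * s).
  rewrite {1}rr (le_trans (sum_cauchy_schwarz _ _))// -(parseval_norm fE bv).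
  rewrite ler_wpM2l ?sqr_ge0// /s mulr_sumr; apply: ler_sum => i _.
  rewrite -exprMn -[leLHS]real_normK ?num_real//.
  by rewrite ler_pXn2r ?nnegrE ?mulr_ge0// ip_le_norm.
have [r0 _|r0] := eqVneq `|r| 0.
  by rewrite r0 expr0n mulr_ge0 ?sqr_ge0// sumr_ge0// => i _; exact: sqr_ge0.
have r2 : 0 < `|r| ^+ 2 by rewrite exprn_gt0// lt_def r0 normr_ge0.
by rewrite mulrCA expr2 ler_pM2l.
Qed.

Lemma pythagoras m (a : 'I_m -> V) v :
  `|v| ^+ 2 = `|orth_proj (linear_span a) v| ^+ 2 +
              `|v - orth_proj (linear_span a) v| ^+ 2.
Proof.
have [pv ov] := orth_projP a v; set p := orth_proj _ _ in pv ov *.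
have := ov _ pv; rewrite !ip_norm !(ipBl, ipBr) (ipC p v) => /eqP.
by rewrite subr_eq0 => /eqP ->; rewrite subrr subr0 addrC subrK.
Qed.

End stability.

Section stability_sample.
Context disp (X : measurableType disp) {R : realType} (V : rkhs R X).

Lemma stability_const_frame n d (b f : 'I_d -> V) (x : n.-tuple X) (eps : R) :
  (forall v, linear_span b v -> v = \sum_i ip V v (f i) *: f i) ->
  0 < eps < 1 ->
  (((Num.sqrt (1 - eps ^+ 2))^-1)%:E <= stability_const (linear_span b) x)%E ->
  eps ^+ 2 <= \sum_i `|f i - orth_proj (sample_space x) (f i)| ^+ 2.
Proof.
move=> fE /andP[e0 e1] H; rewrite leNgt; apply/negP.
set t := \sum_i _ => te; move: H; apply/negP; rewrite -ltNge.
have t0 : 0 <= t by apply: sumr_ge0 => i _; exact: sqr_ge0.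
have e21 : eps ^+ 2 < 1 by rewrite expr_lt1// ltW.
have t1 : 0 < 1 - t by rewrite subr_gt0 (lt_trans te).
apply: (@le_lt_trans _ _ ((Num.sqrt (1 - t))^-1)%:E); last first.
  have e2 : 0 < 1 - eps ^+ 2 by rewrite subr_gt0.
  rewrite lte_fin ltf_pV2 ?posrE; [|by rewrite sqrtr_gt0..].
  by rewrite ltr_sqrt// ltrD2l ltrN2.
apply: ub_ereal_sup => _ [v [bv /eqP v0] <-].
have vpos : 0 < `|v| by rewrite normr_gt0.
have := residual_le_frame (fun i => ksec V (tnth x i)) fE bv.
rewrite -/(sample_space x) -/t => res.
have pyth := pythagoras (fun i => ksec V (tnth x i)) v.
rewrite -/(sample_space x) in pyth.
set p := orth_proj _ _ in res pyth *.
have pge : (1 - t) * `|v| ^+ 2 <= `|p| ^+ 2.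
  rewrite mulrBl mul1r {1}pyth; move: res; rewrite mulrC; lra.
have p2 : 0 < `|p| ^+ 2 by apply: lt_le_trans pge; rewrite mulr_gt0// exprn_gt0.
have p0 : 0 < `|p|.
  by rewrite lt_def normr_ge0 andbT; apply: contraTneq p2 => ->; rewrite expr0n ltxx.
rewrite inver gt_eqF// -EFinM lee_fin ler_pdivrMr// ler_pdivlMl ?sqrtr_gt0//.
by rewrite -(ler_pXn2r (n := 2)) ?nnegrE ?mulr_ge0 ?sqrtr_ge0// exprMn sqr_sqrtr ?(ltW t1)//.
Qed.

End stability_sample.

(** * Mean squared residuals under volume sampling *)
Section volume_sampling_moments.
Context disp (X : measurableType disp) {R : realType} (nu : probability X R)
  (V : rkhs R X) (lam : nat -> R) (phi : nat -> V).
Hypothesis embedV : compactly_embedded nu V.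
Hypothesis trace_fin : (\int[nu]_x (rkernel V x x)%:E < +oo)%E.
Hypothesis spec : spectral_decomposition nu lam phi.
Variable n : nat.

Let lam_gt0 := spectral_pos spec.
Let mk := measurable_rkernel_diag embedV spec.
Local Notation e := (eigenbasis lam phi).
Let orth_e := orthonormal_eigenbasis embedV trace_fin spec.
Let total_e := total_eigenbasis embedV trace_fin spec.
Local Notation P := (power_probability nu n).

Definition ksections (x : n.-tuple X) (i : 'I_n) : V := ksec V (tnth x i).

Lemma kernel_mxE x : kernel_mx V x = gram (ksections x).
Proof. by apply/matrixP => i j; rewrite !mxE rkernelE. Qed.

Lemma ksections_moments (p q : 'I_n -> nat) :
  P.-integrable [set: n.-tuple X] (EFin \o (fun x => \prod_(i < n)
    (ip V (ksections x i) (e (p i)) * ip V (ksections x i) (e (q i))))) /\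
  (\int[P]_x (\prod_(i < n)
      (ip V (ksections x i) (e (p i)) * ip V (ksections x i) (e (q i))))%:E
    = (\prod_(i < n) ((p i == q i)%:R * lam (q i)))%:E)%E.
Proof.
pose f i y := ip V (ksec V y) (e (p i)) * ip V (ksec V y) (e (q i)).
have fE i : f i = (fun y => ev V (e (p i)) y * ev V (e (q i)) y).
  by apply/funext => y; rewrite /f !reproducing !(ipC (ksec V y)).
have intf i : nu.-integrable [set: X] (EFin \o f i).
  by rewrite fE; exact: integrable_ev_mul.
have [intP PE] := integral_prod_tnth intf.
split => //; rewrite PE; congr EFin; apply: eq_bigr => i _.
rewrite fE; exact: (l2_eigenbasis embedV trace_fin spec).
Qed.

Lemma ksections_norm :
  P.-integrable [set: n.-tuple X]
    (EFin \o (fun x => \prod_(i < n) `|ksections x i| ^+ 2)).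
Proof.
have intk (i : 'I_n) : nu.-integrable [set: X] (EFin \o (fun y => rkernel V y y)).
  exact: integrable_rkernel_diag mk trace_fin.
have [+ _] := integral_prod_tnth intk.
rewrite (_ : (fun x => \prod_(i < n) rkernel V (tnth x i) (tnth x i)) =
  (fun x => \prod_(i < n) `|ksections x i| ^+ 2))//.
by apply/funext => x; apply: eq_bigr => i _; rewrite rkernelE ip_norm.
Qed.

Lemma integral_det_kernel :
  P.-integrable [set: n.-tuple X] (EFin \o (fun x => \det (gram (ksections x)))) /\
  inj_sum lam n M @[M --> \oo] --> \int[P]_x \det (gram (ksections x)).
Proof.
have [| | |intD cv] := @integral_det_gram _ _ _ P _ _ _ orth_e total_e n ksections
  (fun _ p q => (p == q)%:R * lam q).
- exact: ksections_moments.
- by move=> i j p q _ /negPf ->; rewrite mul0r.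
- exact: ksections_norm.
split => //; move: cv.
rewrite (_ : (fun M => \sum_(u : {ffun 'I_n -> 'I_M} | injectiveb u)
   \prod_i ((u i == u i :> nat)%:R * lam (u i))) = inj_sum lam n)//.
apply/funext => M; apply: eq_bigr => u _; apply: eq_bigr => i _.
by rewrite eqxx mul1r.
Qed.

Lemma integral_det_kernel_gt0 : 0 < \int[P]_x \det (gram (ksections x)).
Proof.
have [_ cv] := integral_det_kernel.
apply: (@lt_le_trans _ _ (\prod_(i < n) lam i)).
  by apply: prodr_gt0 => i _; exact: lam_gt0.
by apply: (cvgr_to_ge cv); exists n => // M /= nM; exact: inj_sum_ge.
Qed.

(** The mean is taken with respect to the unnormalised density: by
    [det_gram_cons] the left integrand is the squared residual of
    v = Sigma^(1/2) w times that density. *)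
Lemma expected_residual (m : nat) (b : R) (v w : V) :
  (m <= n)%N -> 0 <= b ->
  (forall M, \sum_(m <= j < M) lam j <= b * (n.+1 - m)%:R) ->
  (forall j, ip V v (e j) = Num.sqrt (lam j) * ip V w (e j)) ->
  P.-integrable [set: n.-tuple X]
    (EFin \o (fun x => \det (gram (vcons v (ksections x))))) /\
  \int[P]_x \det (gram (vcons v (ksections x))) <=
    b * `|w| ^+ 2 * \int[P]_x \det (gram (ksections x)).
Proof.
move=> mn b0 tail vw.
pose G (i : 'I_n.+1) p q : R := if unlift ord0 i is Some _
  then (p == q)%:R * lam q else ip V v (e p) * ip V v (e q).
have [| | |intD cv] := @integral_det_gram _ _ _ P _ _ _ orth_e total_e n.+1
  (fun x => vcons v (ksections x)) G.
- move=> p q; pose p' i := p (lift ord0 i); pose q' i := q (lift ord0 i).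
  have [intf fE] := ksections_moments p' q'.
  have splitE x : (\prod_(i < n.+1) (ip V (vcons v (ksections x) i) (e (p i)) *
      ip V (vcons v (ksections x) i) (e (q i))))%:E =
    ((ip V v (e (p ord0)) * ip V v (e (q ord0)))%:E *
    (\prod_(i < n) (ip V (ksections x i) (e (p' i)) * ip V (ksections x i) (e (q' i))))%:E)%E.
    rewrite big_ord_recl vcons0 EFinM; congr (_ * _%:E)%E.
    by apply: eq_bigr => i _; rewrite vconsS.
  split.
    have := integrableZl measurableT (ip V v (e (p ord0)) * ip V v (e (q ord0))) intf.
    by apply: eq_integrable => // x _; rewrite /comp splitE.
  under eq_integral do rewrite splitE.
  rewrite (integralZl measurableT intf) fE -EFinM big_ord_recl /G unlift_none.
  by congr (_ * _)%:E; apply: eq_bigr => i _; rewrite liftK.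
- move=> i j p q ji /negPf pq; rewrite /G.
  case: (unliftP ord0 i) => [k _|i0]; first by rewrite pq mul0r.
  by rewrite i0 ltn0 in ji.
- have := integrableZl measurableT (`|v| ^+ 2) ksections_norm.
  rewrite (_ : (fun x => _) = EFin \o (fun x =>
    \prod_(i < n.+1) `|vcons v (ksections x) i| ^+ 2))//.
  apply/funext => x /=; rewrite big_ord_recl vcons0 EFinM; congr (_ * _%:E)%E.
  by apply: eq_bigr => i _; rewrite vconsS.
split => //.
have [_ cvD] := integral_det_kernel.
have cvb : b * `|w| ^+ 2 * inj_sum lam n M @[M --> \oo] -->
    b * `|w| ^+ 2 * \int[P]_x \det (gram (ksections x)) by exact: cvgMl_tmp.
apply: (ler_cvg_to cv cvb); exists 0%N => // M _ /=.
apply: (@le_trans _ _ (b * (\sum_(j < M) ip V w (e j) ^+ 2) * inj_sum lam n M)); last first.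
  rewrite ler_wpM2r ?inj_sum_ge0// ler_wpM2l//; exact: bessel.
apply: le_trans (inj_sum_ratio lam_gt0 (fun j => ip V w (e j)) mn b0 (tail M)).
apply: ler_sum => u _; rewrite le_eqVlt; apply/orP; left; apply/eqP.
rewrite !big_ord_recl /G unlift_none vw mulrA; congr (_ * _).
  rewrite -{3}(sqr_sqrt_lam spec) expr2; ring.
by apply: eq_bigr => i _; rewrite liftK eqxx mul1r.
Qed.

End volume_sampling_moments.

(** * The tail bound *)
Section volume_sampling_bound.
Context disp (X : measurableType disp) {R : realType} (nu : probability X R)
  (V : rkhs R X) (lam : nat -> R) (phi : nat -> V).
Hypothesis embedV : compactly_embedded nu V.
Hypothesis trace_fin : (\int[nu]_x (rkernel V x x)%:E < +oo)%E.
Hypothesis spec : spectral_decomposition nu lam phi.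


(** Markov's inequality for the sum of the squared residuals of a Parseval frame
    of V_d. *)
Lemma volume_sampling_stability_le n d (bW : 'I_d -> V) (eps b C : R) m :
  (m <= n)%N -> 0 <= b ->
  (forall M, \sum_(m <= j < M) lam j <= b * (n.+1 - m)%:R) ->
  linear_span bW `<=` range (spectral_power nu lam phi 2^-1) ->
  smoothness_const nu lam phi (linear_span bW) = C%:E ->
  0 < eps < 1 ->
  (volume_sampling nu V [set x : n.-tuple X |
     (((Num.sqrt (1 - eps ^+ 2))^-1)%:E <= stability_const (linear_span bW) x)%E]
   <= (d%:R * C ^+ 2 * b / eps ^+ 2)%:E)%E.
Proof.
move=> mn b0 tail Wrange CE eps01.
have [e0 _] := andP eps01.
have e2 : 0 < eps ^+ 2 by rewrite exprn_gt0.
have [f [fW fE]] := parseval_frame bW.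
(* The ratio defining the smoothness constant only ranges over nonzero vectors,
   so a vanishing frame vector, whose residual is 0, is treated apart. *)
pose w i := if `|f i| == 0 then 0 else spectral_power nu lam phi (- 2^-1) (f i).
have wC i : `|w i| ^+ 2 <= C ^+ 2.
  rewrite /w; case: ifPn => [_|fi0]; first by rewrite normr0 expr0n sqr_ge0.
  have fi : 0 < `|f i| by rewrite lt_def fi0 normr_ge0.
  have ratioC : `|spectral_power nu lam phi (- 2^-1) (f i)| / `|f i| <= C.
    rewrite -lee_fin -CE; apply: ereal_sup_ubound; exists (f i) => //; split=> //.
    by move=> /= f0; rewrite f0 normr0 eqxx in fi0.
  have C0 : 0 <= C by apply: le_trans ratioC; rewrite divr_ge0.
  rewrite ler_pXn2r ?nnegrE//; apply: (@le_trans _ _ (C * `|f i|)).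
    by rewrite -ler_pdivrMr.
  by rewrite ler_piMr// (parseval_le1 fE).
have coef i j : ip V (f i) (eigenbasis lam phi j) =
    Num.sqrt (lam j) * ip V (w i) (eigenbasis lam phi j).
  rewrite /w; case: ifPn => [/eqP/normr0_eq0 ->|_]; first by rewrite !ip0l mulr0.
  by rewrite (spectral_power_inv_coef embedV trace_fin spec)//; exact: Wrange.
set P := power_probability nu n.
pose A i (x : n.-tuple X) := \det (gram (vcons (f i) (ksections V x))).
have intA i : P.-integrable [set: n.-tuple X] (EFin \o A i).
  by have [] := expected_residual embedV trace_fin spec mn b0 tail (coef i).
pose D := \int[P]_x \det (gram (ksections V x)).
have D0 : 0 < D := integral_det_kernel_gt0 embedV trace_fin spec n.
have AD i : \int[P]_x A i x <= b * C ^+ 2 * D.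
  have [_ H] := expected_residual embedV trace_fin spec mn b0 tail (coef i).
  by apply: (le_trans H); rewrite ler_wpM2r ?(ltW D0)// ler_wpM2l.
have [intD _] := integral_det_kernel embedV trace_fin spec n.
have DE : (\int[P]_x (\det (kernel_mx V x))%:E = D%:E)%E.
  under eq_integral do rewrite kernel_mxE.
  by rewrite /D /Rintegral fineK//; exact: (integrable_fin_num measurableT intD).
rewrite /volume_sampling -/P DE inver gt_eqF//.
set S := [set x | _].
have H : (\int[P]_(x in S) (\det (kernel_mx V x))%:E <=
    (d%:R * C ^+ 2 * b / eps ^+ 2 * D)%:E)%E.
  rewrite integral_mkcond.
  apply: (@le_trans _ _ (\int[P]_x ((eps ^- 2)%:E * \sum_(i < d) (A i x)%:E))%E).
    apply: lower_integral_le => x; rewrite patchE; case: ifPn => // xS.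
    - by rewrite kernel_mxE lee_fin det_gram_ge0.
    - move: xS; rewrite inE => /(stability_const_frame fE eps01) res.
      rewrite sumEFin -EFinM lee_fin mulrC ler_pdivlMr// /A kernel_mxE.
      under eq_bigr do rewrite det_gram_cons.
      by rewrite -mulr_suml mulrC ler_wpM2r// det_gram_ge0.
    - rewrite sumEFin -EFinM lee_fin mulr_ge0 ?invr_ge0 ?(ltW e2)//.
      by rewrite sumr_ge0// => i _; exact: det_gram_ge0.
  have intS : P.-integrable [set: n.-tuple X] (fun x => \sum_(i < d) (A i x)%:E)%E.
    by apply: integrable_sum => // i _; exact: intA.
  rewrite (integralZl measurableT intS) (integral_sum measurableT)//.
  have AE i : (\int[P]_x (A i x)%:E = (\int[P]_x A i x)%:E)%E.
    by rewrite /Rintegral fineK//; exact: (integrable_fin_num measurableT (intA i)).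
  under eq_bigr do rewrite AE.
  rewrite sumEFin -EFinM lee_fin.
  have -> : d%:R * C ^+ 2 * b / eps ^+ 2 * D = eps ^- 2 * (\sum_(i < d) b * C ^+ 2 * D).
    rewrite sumr_const card_ord -mulr_natl; ring.
  by rewrite ler_wpM2l ?invr_ge0 ?(ltW e2)// ler_sum.
apply: (@le_trans _ _ ((d%:R * C ^+ 2 * b / eps ^+ 2 * D)%:E * (D^-1)%:E)%E).
  by rewrite lee_wpmul2r// lee_fin invr_ge0 ltW.
by rewrite -EFinM mulfK ?gt_eqF.
Qed.

End volume_sampling_bound.

Theorem corollary10 (R : realType) (c c' : R) (hc : 0 < c) (hc' : 0 < c') :
  exists Balg Bexp : R -> R,
  [/\ asymp [set s | 2^-1 < s] Balg
        (fun s => (1 + (2 * s - 1)^-1) `^ (2 * s)),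
      asymp [set alpha | 0 < alpha < 1] Bexp
        (fun alpha => alpha / (1 - alpha)) &
  forall (disp : measure_display) (X : measurableType disp)
    (nu : probability X R) (V : rkhs R X) (lam : nat -> R) (phi : nat -> V)
    (B : R),
  compactly_embedded nu V ->
  (\int[nu]_x (rkernel V x x)%:E < +oo)%E ->
  spectral_decomposition nu lam phi ->
  (exists s : R, [/\ 2^-1 < s,
      asymp_with c c' [set: nat] lam (fun m => m.+1%:R `^ (- (2 * s))) &
      B = Balg s]) \/
  (exists alpha : R, [/\ 0 < alpha < 1,
      asymp_with c c' [set: nat] lam (fun m => alpha ^+ m.+1) &
      B = Bexp alpha]) ->
  (forall (n d : nat) (Vd : set V) (eps : R),
     (0 < n)%N -> (0 < d)%N ->
     subspace_of_dim d Vd ->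
     Vd `<=` range (spectral_power nu lam phi 2^-1) ->
     0 < eps < 1 ->
     (volume_sampling nu V
        [set x : n.-tuple X |
           ((Num.sqrt (1 - eps ^+ 2))^-1)%:E <= stability_const Vd x]
      <= ((2 + B) * d%:R)%:E * smoothness_const nu lam phi Vd ^+ 2
         * (lam n.-1)%:E / (eps ^+ 2)%:E)%E) /\
  (forall d : nat, (0 < d)%N ->
     (smoothness_const nu lam phi (linear_span (fun i : 'I_d => phi i)) ^+ 2
      = ((lam d.-1)^-1)%:E)%E)].
Proof.
pose q := c' / c; have q0 : 0 < q by rewrite divr_gt0.
exists (fun s => q * (1 + (2 * s - 1)^-1) `^ (2 * s)),
  (fun alpha => q * (alpha / (1 - alpha))); split.
- by exists q, q; split => // s _; rewrite !lexx.
- by exists q, q; split => // alpha _; rewrite !lexx.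
move=> disp X nu V lam phi B embedV trace_fin spec decay.
have lam_gt0 := spectral_pos spec.
split; last first.
  by move=> d d0; exact: (smoothness_const_eigenspace embedV trace_fin spec).
move=> n d Vd eps n0 d0 [bW _ ->] Wrange eps01.
have [e0 _] := andP eps01.
have [B0 [m mn tail]] : 0 <= B /\ exists2 m, (m <= n)%N &
    forall M, \sum_(m <= j < M) lam j <= B * lam n.-1 * (n.+1 - m)%:R.
  case: decay => [[s [s2 lamE ->]]|[alpha [a01 lamE ->]]].
    split; first by rewrite mulr_ge0 ?powR_ge0 ?ltW.
    exact: alg_decay_tail lamE.
  have /andP[a0 a1] := a01; split; last exact: exp_decay_tail lamE.
  by rewrite !mulr_ge0 ?invr_ge0 ?subr_ge0 ?ltW.
have lamn := lam_gt0 n.-1.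
have Bd : 0 < (2 + B) * d%:R by rewrite mulr_gt0 ?ltr0n// ltr_wpDr.
have e2 : 0 < eps ^- 2 by rewrite invr_gt0 exprn_gt0.
have einv : ((eps ^+ 2)%:E^-1 = (eps ^- 2)%:E)%E.
  by rewrite inver gt_eqF// exprn_gt0.
rewrite einv.
(* An infinite smoothness constant makes the right side infinite. *)
have [[C CE]|smooth_oo] : (exists C, smoothness_const nu lam phi (linear_span bW) = C%:E)
    \/ (smoothness_const nu lam phi (linear_span bW) ^+ 2 = +oo)%E.
  case: (smoothness_const _ _ _ _) => [C| |]; first by left; exists C.
  - by right; rewrite expe2.
  - by right; rewrite expe2.
- apply: (le_trans (volume_sampling_stability_le embedV trace_fin spec mn _ tail Wrange CE eps01)).
    by rewrite mulr_ge0// ltW.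
  rewrite CE -EFin_expe -!EFinM lee_fin.
  rewrite ler_wpM2r ?(ltW e2)//.
  have -> : (2 + B) * d%:R * C ^+ 2 * lam n.-1 =
      d%:R * C ^+ 2 * (B * lam n.-1) + 2 * d%:R * C ^+ 2 * lam n.-1 by ring.
  by rewrite lerDl mulr_ge0 ?(ltW lamn)// mulr_ge0 ?sqr_ge0// mulr_ge0.
- by rewrite smooth_oo gt0_muley ?lte_fin// gt0_mulye ?lte_fin// gt0_mulye ?lte_fin// leey.
Qed.
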